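(* For every $t\in[0,T]$ the function $\xi\mapsto E(t,\xi)$ has a unique minimizer over $\mathbb{R}^n$, so that the state estimator $$\widehat{x}_{\mathrm E}(t)=\operatorname*{arg\,min}_{\xi\in\mathbb{R}^n}E(t,\xi)$$ is well-defined. Moreover, for every $t\in[0,T]$, $$\widehat{x}_{\mathrm E}(t)=\mathcal{P}^{-1}(t)\sum_{k=1}^N P_k(t)\,\widehat{x}_k(t),\qquad \mathcal{P}(t)=\sum_{k=1}^N P_k(t).$$
   Context: Let $T>0$, $n,m,r\in\mathbb{N}$, $B\in\mathbb{R}^{n,m}$, $C\in\mathbb{R}^{r,n}$, $x_0\in\mathbb{R}^n$ and $y\in L^2(0,T;\mathbb{R}^r)$. For a symmetric positive definite matrix $M$ set $\|z\|_M^2=z^\top M z$. Uncertain parameters: $\Sigma_A,\Sigma_\Gamma,\Sigma_R,\Sigma_Q$ are nonempty finite subsets of Euclidean spaces, $\Sigma=\Sigma_A\times\Sigma_\Gamma\times\Sigma_R\times\Sigma_Q=\{\sigma_1,\dots,\sigma_N\}$ has $N$ elements and carries the uniform probability measure, so $\mathbb{E}[f(\sigma)]=\frac1N\sum_{k=1}^N f(\sigma_k)$. Each $\sigma=(\sigma_A,\sigma_\Gamma,\sigma_R,\sigma_Q)\in\Sigma$ determines a matrix $A_\sigma\in\mathbb{R}^{n,n}$ (depending only on $\sigma_A$) and symmetric positive definite matrices $\Gamma_\sigma\in\mathbb{R}^{n,n}$ (depending only on $\sigma_\Gamma$), $R_\sigma\in\mathbb{R}^{m,m}$ (depending only on $\sigma_R$),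 $Q_\sigma\in\mathbb{R}^{r,r}$ (depending only on $\sigma_Q$). Index $k$ stands for $\sigma_k$, e.g. $A_k=A_{\sigma_k}$. For each $k$, $\Pi_k$ is the unique solution on $[0,T]$ of $$\dot\Pi_k=A_k\Pi_k+\Pi_kA_k^\top-\Pi_kC^\top Q_k^{-1}C\Pi_k+BR_kB^\top,\quad \Pi_k(0)=\Gamma_k,$$ $\widehat{x}_k$ is the unique solution of $$\dot{\widehat{x}}_k=A_k\widehat{x}_k+\Pi_kC^\top Q_k^{-1}(y-C\widehat{x}_k),\quad \widehat{x}_k(0)=x_0,$$ and $P_k(t)=\Pi_k^{-1}(t)$, which is the unique solution of $\dot P_k=-A_k^\top P_k-P_kA_k-P_kBR_kB^\top P_k+C^\top Q_k^{-1}C$, $P_k(0)=\Gamma_k^{-1}$. The value function $\mathcal{V}_k$ is defined, for $t\in(0,T]$ and $\xi\in\mathbb{R}^n$, by $$\mathcal{V}_k(t,\xi)=\inf\Big\{\tfrac12\|x(0)-x_0\|_{\Gamma_k^{-1}}^2+\tfrac12\int_0^t\|v(s)\|_{R_k^{-1}}^2+\|y(s)-Cx(s)\|_{Q_k^{-1}}^2\,\mathrm{d}s\Big\},$$ the infimum being over $x\in H^1(0,t;\mathbb{R}^n)$, $v\in L^2(0,t;\mathbb{R}^m)$ with $\dot x=A_kx+Bv$ on $(0,t)$ and $x(t)=\xi$; and $\mathcal{V}_k(0,\xi)=\frac12\|\xi-x_0\|_{\Gamma_k^{-1}}^2$. It is given by $$\mathcal{V}_k(t,\xi)=\tfrac12(\xi-\widehat{x}_k(t))^\top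 P_k(t)(\xi-\widehat{x}_k(t))+\tfrac12\int_0^t\|y(s)-C\widehat{x}_k(s)\|_{Q_k^{-1}}^2\,\mathrm{d}s.$$ The expected energy $E:[0,T]\times\mathbb{R}^n\to\mathbb{R}$ is $$E(t,\xi)=\mathbb{E}[\mathcal{V}_\sigma(t,\xi)]=\frac1N\sum_{k=1}^N\mathcal{V}_k(t,\xi)=\frac{1}{2N}\sum_{k=1}^N\Big((\xi-\widehat{x}_k(t))^\top P_k(t)(\xi-\widehat{x}_k(t))+\int_0^t\|y(s)-C\widehat{x}_k(s)\|_{Q_k^{-1}}^2\,\mathrm{d}s\Big).$$ *)

(* Defs.v *)
From HB Require Import structures.
From mathcomp Require Import all_boot all_order all_algebra.
From mathcomp Require Import finmap.
From mathcomp Require Import all_classical all_reals all_analysis.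

Set Implicit Arguments.
Unset Strict Implicit.
Unset Printing Implicit Defensive.

Import Order.TTheory GRing.Theory Num.Theory.
Import numFieldNormedType.Exports.

Local Open Scope classical_set_scope.
Local Open Scope ring_scope.

Definition sqnorm (R : realType) (n : nat) (M : 'M[R]_n) (z : 'cV[R]_n) : R :=
  (z^T *m M *m z) 0 0.

Definition spd (R : realType) (n : nat) (M : 'M[R]_n) : Prop :=
  M^T = M /\ forall z : 'cV[R]_n, z != 0 -> 0 < sqnorm M z.

(* L^2(0,t; R^n), by Borel representatives defined on the whole line whose
   values outside ]0, t[ are irrelevant. *)
Definition L2 (R : realType) (n : nat) (t : R) (f : R -> 'cV[R]_n) : Prop :=
  forall i, (fun s => f s i 0) \_ `]0, t[ \in Lfun lebesgue_measure 2%:E.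

(* x is the continuous representative of an element of H^1(0,t; R^n) with
   weak derivative dx: on an interval, x is the primitive of dx in L^2. *)
Definition H1 (R : realType) (n : nat) (t : R) (x dx : R -> 'cV[R]_n) : Prop :=
  L2 t dx /\
  forall s, s \in `[0, t] -> forall i,
    x s i 0 = x 0 i 0 + \int[lebesgue_measure]_(u in `[0, s]) dx u i 0.

Definition H1_solution (R : realType) (n : nat) (t : R)
    (x rhs : R -> 'cV[R]_n) : Prop :=
  exists2 dx, H1 t x dx &
    {ae lebesgue_measure, forall s, s \in `]0, t[ -> dx s = rhs s}.

Definition cost (R : realType) (n m r : nat) (Gam : 'M[R]_n) (Rm : 'M[R]_m)
    (Q : 'M[R]_r) (C : 'M[R]_(r, n)) (x0 : 'cV[R]_n) (y : R -> 'cV[R]_r)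
    (t : R) (x : R -> 'cV[R]_n) (v : R -> 'cV[R]_m) : R :=
  2^-1 * sqnorm (invmx Gam) (x 0 - x0) +
  2^-1 * \int[lebesgue_measure]_(s in `[0, t])
    (sqnorm (invmx Rm) (v s) + sqnorm (invmx Q) (y s - C *m x s)).

Definition admissible (R : realType) (n m : nat) (A : 'M[R]_n)
    (B : 'M[R]_(n, m)) (t : R) (xi : 'cV[R]_n)
    (x : R -> 'cV[R]_n) (v : R -> 'cV[R]_m) : Prop :=
  [/\ L2 t v, H1_solution t x (fun s => A *m x s + B *m v s) & x t = xi].

Definition value (R : realType) (n m r : nat) (A Gam : 'M[R]_n) (Rm : 'M[R]_m)
    (Q : 'M[R]_r) (B : 'M[R]_(n, m)) (C : 'M[R]_(r, n)) (x0 : 'cV[R]_n)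
    (y : R -> 'cV[R]_r) (t : R) (xi : 'cV[R]_n) : R :=
  if t == 0 then 2^-1 * sqnorm (invmx Gam) (xi - x0)
  else inf [set c | exists x v, admissible A B t xi x v /\
                      c = cost Gam Rm Q C x0 y t x v].

Definition riccati_solution (R : realType) (n m r : nat) (T : R)
    (A Gam : 'M[R]_n) (Rm : 'M[R]_m) (Q : 'M[R]_r) (B : 'M[R]_(n, m))
    (C : 'M[R]_(r, n)) (Pi : R -> 'M[R]_n) : Prop :=
  [/\ {within `[0, T], continuous Pi},
      forall t : R, t \in `]0, T[ ->
        is_derive t 1 Pi (A *m Pi t + Pi t *m A^T
          - Pi t *m C^T *m invmx Q *m C *m Pi t + B *m Rm *m B^T)
    & Pi 0 = Gam].

Definition filter_solution (R : realType) (n r : nat) (T : R)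
    (A : 'M[R]_n) (Q : 'M[R]_r) (C : 'M[R]_(r, n)) (x0 : 'cV[R]_n)
    (y : R -> 'cV[R]_r) (Pi : R -> 'M[R]_n) (xh : R -> 'cV[R]_n) : Prop :=
  H1_solution T xh
    (fun t => A *m xh t + Pi t *m C^T *m invmx Q *m (y t - C *m xh t)) /\
  xh 0 = x0.

(* A parameter is nested as (((sA, sGamma), sR), sQ), each component being a
   point of a Euclidean space. *)
Definition param (R : realType) (dA dG dR dQ : nat) : choiceType :=
  ('rV[R]_dA * 'rV[R]_dG * 'rV[R]_dR * 'rV[R]_dQ)%type.

Definition Sigma (R : realType) (dA dG dR dQ : nat)
    (SA : {fset 'rV[R]_dA}) (SG : {fset 'rV[R]_dG})
    (SR : {fset 'rV[R]_dR}) (SQ : {fset 'rV[R]_dQ}) :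
    {fset param R dA dG dR dQ} :=
  (SA `*` SG `*` SR `*` SQ)%fset.

Definition parA (R : realType) (dA dG dR dQ : nat) (s : param R dA dG dR dQ) :
  'rV[R]_dA := s.1.1.1.
Definition parGamma (R : realType) (dA dG dR dQ : nat) (s : param R dA dG dR dQ) :
  'rV[R]_dG := s.1.1.2.
Definition parR (R : realType) (dA dG dR dQ : nat) (s : param R dA dG dR dQ) :
  'rV[R]_dR := s.1.2.
Definition parQ (R : realType) (dA dG dR dQ : nat) (s : param R dA dG dR dQ) :
  'rV[R]_dQ := s.2.

Definition unif_expectation (R : realType) (K : choiceType) (S : {fset K})
    (f : K -> R) : R :=
  (#|` S|%:R)^-1 * \sum_(s <- S) f s.

Definition is_minimizer (R : realType) (n : nat) (f : 'cV[R]_n -> R)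
    (xi : 'cV[R]_n) : Prop :=
  forall zeta, f xi <= f zeta.

Definition argmin (R : realType) (n : nat) (f : 'cV[R]_n -> R) : 'cV[R]_n :=
  xget 0 [set xi | is_minimizer f xi].

Definition expected_energy (R : realType) (n m r dA dG dR dQ : nat)
    (SA : {fset 'rV[R]_dA}) (SG : {fset 'rV[R]_dG})
    (SR : {fset 'rV[R]_dR}) (SQ : {fset 'rV[R]_dQ})
    (A : 'rV[R]_dA -> 'M[R]_n) (Gam : 'rV[R]_dG -> 'M[R]_n)
    (Rm : 'rV[R]_dR -> 'M[R]_m) (Q : 'rV[R]_dQ -> 'M[R]_r)
    (B : 'M[R]_(n, m)) (C : 'M[R]_(r, n)) (x0 : 'cV[R]_n)
    (y : R -> 'cV[R]_r) (t : R) (xi : 'cV[R]_n) : R :=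
  unif_expectation (Sigma SA SG SR SQ) (fun s =>
    value (A (parA s)) (Gam (parGamma s)) (Rm (parR s)) (Q (parQ s)) B C x0 y t xi).

(* Main.v *)
Require Import Defs.
From HB Require Import structures.
From mathcomp Require Import all_boot all_order all_algebra.
From mathcomp Require Import finmap.
From mathcomp Require Import all_classical all_reals all_analysis.
From mathcomp Require Import measurable_realfun ring lra.

Set Implicit Arguments.
Unset Strict Implicit.
Unset Printing Implicit Defensive.

Import Order.TTheory GRing.Theory Num.Theory.
Import numFieldNormedType.Exports.

Local Open Scope classical_set_scope.
Local Open Scope ring_scope.

(** The theorem is a statement about sums of strictly convex quadratics once
    each value function is known to be
      [V(t, xi) = 1/2 (xi - xh(t))^T Pi(t)^-1 (xi - xh(t)) + c(t)],
    with [Pi(t)] symmetric positive definite: completing the square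
    ([sum_sqnorm_weighted_mean]) rewrites the mean of such functions as a
    constant plus a positive multiple of the squared [calP(t)]-norm of
    [xi - calP(t)^-1 sum P_k(t) xh_k(t)], and [calP(t)] is positive definite.
    The work lies in deriving this form from the definition of [V] as an
    infimum over trajectories in H^1 and controls in L^2.

    Absolutely continuous functions are handled through the relation
    [primitive t f df]: on [[0, t]], [f] is [f 0] plus the Lebesgue integral of
    the integrable function [df].  All the calculus rests on the product rule
    [primitiveM] for such functions, which is Fubini on a triangle
    ([integral_triangle]), and on the existence of a fundamental matrix for
    [Z' = G Z] with bounded measurable [G] ([fundamental_matrix], a Picard
    series summed by dominated convergence).  If moreover [Y' = - Y G], then
    [(Y Z)' = 0], so [Y] and [Z] are inverse to each other
    ([transition_matrices]), and conjugation by [Y] turns every linear equation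
    at hand into an integration.

    With [S = C^T Q^-1 C] and [F = A - Pi S], the difference
    [D = Pi - Pi^T] solves [D' = F D + D F^T], hence [Y D Y^T] is constant and vanishes
    ([riccati_symm]).  Then [(Y Pi Y^T)' = Y (Pi S Pi + B R B^T) Y^T >= 0], so
    [Y Pi Y^T] dominates [Gam] and [Pi] is positive definite ([riccati_spd]).

    In the computation of the value function the costate [p] takes the place of
    [Pi^-1 (x - xh)].  With [eta = y - C xh], let [p' = - F^T p - C^T Q^-1 eta] and
    [p(t) = Pi(t)^-1 (xi - xh(t))].  Then [xh + Pi p] with control [R B^T p] is
    an admissible trajectory ending at [xi].  Differentiating [p^T Pi p] yields
    its cost ([optimal_cost]), and differentiating [p^T d], where [d] is the
    deviation of another admissible trajectory, shows that the first variation
    of the cost vanishes, so by convexity this trajectory is optimal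
    ([optimal_cost_le]). *)

(** * Classes of scalar functions on [[0, t]] *)

Section FunctionClasses.
Context {R : realType}.
Notation mu := (@lebesgue_measure R).
Implicit Types (t s : R) (f g df dg : R -> R).

Definition integrable_on t f := mu.-integrable `[0, t] (EFin \o f).

Definition bounded_measurable t f :=
  measurable_fun `[0, t] f /\ exists M, forall s, s \in `[0, t] -> `|f s| <= M.

Definition square_integrable t f :=
  measurable_fun `[0, t] f /\ integrable_on t (fun s => f s ^+ 2).

Lemma integrable_on_measurable t f :
  integrable_on t f -> measurable_fun `[0, t] f.
Proof. by move=> /measurable_int/measurable_EFinP. Qed.

Lemma integrable_on0 t : integrable_on t (fun=> 0).
Proof. exact: integrable0. Qed.

Lemma integrable_onD t f g : integrable_on t f -> integrable_on t g ->
  integrable_on t (fun s => f s + g s).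
Proof.
move=> intf intg.
exact: (@integrableD _ _ _ mu `[0, t] _ (EFin \o f) (EFin \o g)).
Qed.

Lemma integrable_onN t f : integrable_on t f -> integrable_on t (fun s => - f s).
Proof. by move=> intf; exact: (@integrableN _ _ _ mu `[0, t] (EFin \o f)). Qed.

Lemma integrable_on_le t s f : s <= t -> integrable_on t f -> integrable_on s f.
Proof.
move=> st; apply: integrableS => //.
by apply: subset_itvl; rewrite bnd_simp.
Qed.

Lemma bounded_measurable_cst t c : bounded_measurable t (fun=> c).
Proof. by split; [exact: measurable_cst|exists `|c|]. Qed.

Lemma bounded_measurableD t f g : bounded_measurable t f ->
  bounded_measurable t g -> bounded_measurable t (fun s => f s + g s).
Proof.
move=> [mf [M fM]] [mg [N gN]]; split; first exact: measurable_funD.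
exists (M + N) => s st.
by rewrite (le_trans (ler_normD _ _))// lerD ?fM ?gN.
Qed.

Lemma bounded_measurableM t f g : bounded_measurable t f ->
  bounded_measurable t g -> bounded_measurable t (fun s => f s * g s).
Proof.
move=> [mf [M fM]] [mg [N gN]]; split; first exact: measurable_funM.
exists (M * N) => s st.
by rewrite normrM ler_pM ?fM ?gN.
Qed.

Lemma integrable_on_mull t f g : bounded_measurable t f -> integrable_on t g ->
  integrable_on t (fun s => f s * g s).
Proof.
move=> [mf [M fM]] intg; apply: (@integrableMr _ _ _ mu _ _ f (EFin \o g)) => //.
exists M; split; first exact: num_real.
by move=> x Mx s st /=; rewrite (le_trans (fM _ st))// ltW.
Qed.

Lemma integrable_on_mulr t f g : integrable_on t f -> bounded_measurable t g ->
  integrable_on t (fun s => f s * g s).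
Proof.
move=> intf bg; rewrite (_ : (fun s => _) = (fun s => g s * f s)).
  exact: integrable_on_mull.
by apply/funext => s; rewrite mulrC.
Qed.

Lemma bounded_measurable_integrable t f : bounded_measurable t f ->
  integrable_on t f.
Proof.
move=> bf; rewrite (_ : f = (fun s => f s * 1)); last first.
  by apply/funext => s; rewrite mulr1.
apply: integrable_on_mull => //; apply: measurable_bounded_integrable => //.
  by rewrite /= lebesgue_measure_itv/=; case: ifPn => // _; rewrite -EFinB ltry.
exists 1; split; first exact: num_real.
by move=> x ? s _ /=; rewrite normr1 ltW.
Qed.

(** The product is dominated by the squares: [2 |f g| <= f^2 + g^2]. *)
Lemma square_integrableM t f g : square_integrable t f -> square_integrable t g ->
  integrable_on t (fun s => f s * g s).
Proof.
move=> [mf f2] [mg g2].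
have := integrable_onD f2 g2; apply: le_integrable => //.
  by apply/measurable_EFinP; exact: measurable_funM.
move=> s _ /=; rewrite lee_fin [leRHS]ger0_norm ?addr_ge0 ?sqr_ge0//.
rewrite ler_norml; have := sqr_ge0 (f s + g s); have := sqr_ge0 (f s - g s).
by have := sqr_ge0 (f s); have := sqr_ge0 (g s); nra.
Qed.

Lemma square_integrable_integrable t f : square_integrable t f ->
  integrable_on t f.
Proof.
move=> sf; rewrite (_ : f = (fun s => f s * 1)); last first.
  by apply/funext => s; rewrite mulr1.
apply: square_integrableM => //; split; first exact: measurable_cst.
by apply: bounded_measurable_integrable; exact: bounded_measurable_cst.
Qed.

Lemma square_integrableD t f g : square_integrable t f -> square_integrable t g ->
  square_integrable t (fun s => f s + g s).
Proof.
move=> sf sg; have := square_integrableM sf sg; case: sf sg => mf f2 [mg g2] fg.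
split; first exact: measurable_funD.
rewrite (_ : (fun s => _) =
  (fun s => (f s ^+ 2 + (f s * g s + f s * g s)) + g s ^+ 2)).
  by do !apply: integrable_onD.
by apply/funext => s; ring.
Qed.

Lemma square_integrable_mull t f g : bounded_measurable t f ->
  square_integrable t g -> square_integrable t (fun s => f s * g s).
Proof.
move=> bf [mg g2]; split; first by case: bf => mf _; exact: measurable_funM.
rewrite (_ : (fun s => _) = (fun s => (f s * f s) * g s ^+ 2)).
  by apply: integrable_on_mull => //; exact: bounded_measurableM.
by apply/funext => s; ring.
Qed.

Lemma bounded_measurable_square_integrable t f : bounded_measurable t f ->
  square_integrable t f.
Proof.
move=> bf; split; first by case: bf.
by apply: bounded_measurable_integrable; exact: bounded_measurableM.
Qed.

Lemma square_integrable_le t s f : s <= t ->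
  square_integrable t f -> square_integrable s f.
Proof.
move=> st [mf f2]; split; last exact: integrable_on_le f2.
apply: measurable_funS mf => //.
by apply: subset_itvl; rewrite bnd_simp.
Qed.

(** Null endpoints: both measurability and the integral ignore the values at
    [0] and [t]. *)
Lemma integrable_oo_cc t f : mu.-integrable `]0, t[ (EFin \o f) ->
  integrable_on t f.
Proof.
move=> /[dup] /measurable_int/measurable_EFinP/measurable_fun_itv_cc mf.
move=> /integrableP[_ foo]; apply/integrableP; split.
  exact/measurable_EFinP.
rewrite -integral_itv_bndo_bndc; last first.
  apply: measurableT_comp => //; apply/measurable_EFinP.
  by apply: measurable_funS mf => //; apply: subset_itvl; rewrite bnd_simp.
rewrite -integral_itv_obnd_cbnd//.
apply: measurableT_comp => //; apply/measurable_EFinP.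
apply: measurable_funS mf => //; exact: subset_itv_oo_cc.
Qed.

(** Extension by zero turns L^2 of the interval into L^2 of the line, and the two
    boundary points are negligible. *)
Lemma Lfun2P t f :
  f \_ `]0, t[ \in Lfun mu 2%:E <-> square_integrable t f.
Proof.
split=> [f2|[mf f2]].
  split.
    apply: (@measurable_fun_itv_cc _ 0 t false true).
    move: f2; rewrite inE => /andP[+ _]; rewrite inE /= => mf.
    by have := (measurable_restrictT f _).2 mf; exact.
  apply: integrable_oo_cc; apply/integrable_mkcond => //.
  have /= := Lfun2_integrable_sqr f2; apply: eq_integrable => // s _ /=.
  by rewrite !patchE; case: ifP => //= _; rewrite expr0n.
have mf' : measurable_fun setT (f \_ `]0, t[).
  apply: (measurable_restrictT f _).1 => //; apply: measurable_funS mf => //.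
  exact: subset_itv_oo_cc.
rewrite inE; apply/andP; split; rewrite inE//=.
rewrite /finite_norm unlock /Lnorm poweR_lty//.
have : mu.-integrable setT ((EFin \o (fun s => f s ^+ 2)) \_ `]0, t[).
  apply: (integrable_mkcond _ _).1 => //; apply: integrableS f2 => //.
  exact: subset_itv_oo_cc.
move=> /integrableP[_]; apply: le_lt_trans.
rewrite le_eqVlt; apply/orP; left; apply/eqP; apply: eq_integral => s _ /=.
rewrite !patchE; case: ifP => //= _; last by rewrite normr0 powR0// normr0.
by rewrite powR_mulrn// normrX.
Qed.

End FunctionClasses.
(** * Product rule for indefinite Lebesgue integrals *)

Section Triangle.
Context {R : realType}.
Notation mu := (@lebesgue_measure R).
Implicit Types (t s : R) (f g df dg : R -> R).

(** Both sides integrate [f u * g v] over the triangle [0 <= u <= v <= s]; this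
    is Fubini for the function [h] that vanishes off the triangle. *)
Lemma integral_triangle s f g : integrable_on s f -> integrable_on s g ->
  \int[mu]_(u in `[0, s]) (f u * \int[mu]_(v in `[u, s]) g v) =
  \int[mu]_(v in `[0, s]) (\int[mu]_(u in `[0, v]) f u * g v).
Proof.
move=> intf intg.
pose a := f \_ `[0, s]; pose b := g \_ `[0, s].
have inta : mu.-integrable setT (EFin \o a).
  by rewrite -restrict_EFin; apply: (integrable_mkcond _ _).1.
have intb : mu.-integrable setT (EFin \o b).
  by rewrite -restrict_EFin; apply: (integrable_mkcond _ _).1.
have ma : measurable_fun setT a.
  by apply/measurable_EFinP; exact: measurable_int inta.
have mb : measurable_fun setT b.
  by apply/measurable_EFinP; exact: measurable_int intb.
pose h (z : R * R) := (if z.1 <= z.2 then a z.1 * b z.2 else 0)%:E.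
have mh : measurable_fun setT h.
  apply/measurable_EFinP; apply: measurable_fun_ifT => //.
    exact: measurable_fun_ler.
  apply: measurable_funM.
    exact: measurableT_comp.
  exact: measurableT_comp.
have inth : (mu \x mu)%E.-integrable setT h.
  apply/integrable12ltyP => //.
  have /integrableP[_ a_lty] := inta; have /integrableP[_ b_lty] := intb.
  apply: (@le_lt_trans _ _ (\int[mu]_u (`|(a u)%:E| * \int[mu]_v `|(b v)%:E|))%E).
    apply: ge0_le_integral => //.
    - by move=> u _; exact: integral_ge0.
    - apply: (@measurable_fun_fubini_tonelli_F _ _ _ _ _ mu
        (fun z => `|h z|)%E) => //.
      exact: measurableT_comp.
    - apply: emeasurable_funM => //.
      by apply: measurableT_comp => //; exact/measurable_EFinP.
    move=> u _; rewrite -ge0_integralZl//; last first.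
      by apply: measurableT_comp => //; exact/measurable_EFinP.
    apply: ge0_le_integral => //.
    - apply: measurableT_comp => //; apply: measurableT_comp => //.
    - apply: emeasurable_funM => //.
      by apply: measurableT_comp => //; exact/measurable_EFinP.
    move=> v _; rewrite /h /=; case: ifP => _ /=; rewrite ?normr0 lee_fin.
      by rewrite normrM.
    by rewrite mulr_ge0.
  rewrite ge0_integralZr//.
  - by rewrite lte_mul_pinfty// ?integral_ge0// ge0_fin_numE// integral_ge0.
  - by apply: measurableT_comp => //; exact/measurable_EFinP.
  - exact: integral_ge0.
have := Fubini inth.
have in_fin (A : set R) k : measurable A -> A `<=` `[0, s] ->
    mu.-integrable `[0, s] (EFin \o k) ->
    (\int[mu]_(x in A) (k x)%:E = (\int[mu]_(x in A) k x)%:E)%E.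
  move=> mA As intk; rewrite fineK//; apply: integrable_fin_num => //.
  exact: integrableS intk.
rewrite [X in X = _ -> _](_ : _ =
    \int[mu]_(u in `[0%R, s]) (f u * \int[mu]_(v in `[u, s]) g v)%:E)%E; last first.
  rewrite [RHS]integral_mkcond; apply: eq_integral => u _.
  rewrite patchE; case: ifPn => [us|us]; last first.
    apply: integral0_eq => v _; rewrite /h /= /a patchE (negbTE us) mul0r.
    by case: ifP.
  rewrite EFinM -in_fin//; last first.
    apply: subset_itvr; rewrite bnd_simp.
    by move: us; rewrite inE/= in_itv/= => /andP[].
  rewrite -integralZl//; last first.
    apply: integrableS intg => //.
    apply: subset_itvr; rewrite bnd_simp.
    by move: us; rewrite inE/= in_itv/= => /andP[].
  rewrite [RHS]integral_mkcond; apply: eq_integral => v _.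
  rewrite /h /= patchE /a /b !patchE us.
  move: us; rewrite !inE/= !in_itv/= => /andP[u0 us].
  rewrite !mem_setE !in_itv /=; case: (leP u v) => //= uv.
  by rewrite (le_trans u0 uv) /=; case: ifP; rewrite ?mulr0.
rewrite [X in _ = X -> _](_ : _ =
    \int[mu]_(v in `[0%R, s]) (\int[mu]_(u in `[0, v]) f u * g v)%:E)%E; last first.
  rewrite [RHS]integral_mkcond; apply: eq_integral => v _.
  rewrite patchE; case: ifPn => [vs|vs]; last first.
    apply: integral0_eq => u _; rewrite /h /= /b patchE (negbTE vs) mulr0.
    by case: ifP.
  have vs' : v <= s by move: vs; rewrite inE/= in_itv/= => /andP[].
  have sub : `[0, v] `<=` `[0, s] by apply: subset_itvl; rewrite bnd_simp.
  rewrite EFinM -in_fin// -integralZr//; last exact: integrableS intf.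
  rewrite [RHS]integral_mkcond; apply: eq_integral => u _.
  rewrite /h /= patchE /a /b !patchE vs.
  rewrite !mem_setE !in_itv/=; case: (leP u v) => uv; last by rewrite andbF.
  by rewrite (le_trans uv vs') !andbT; case: ifP; rewrite ?mul0r.
by move=> /(congr1 fine).
Qed.

End Triangle.

Section Primitives.
Context {R : realType}.
Notation mu := (@lebesgue_measure R).
Implicit Types (t s : R) (f g df dg : R -> R).

(** [f] is the absolutely continuous function on [[0, t]] with almost everywhere
    derivative [df]. *)
Definition primitive t f df := integrable_on t df /\
  forall s, s \in `[0, t] -> f s = f 0 + \int[mu]_(u in `[0, s]) df u.

Lemma primitive_le t s f df : s <= t -> primitive t f df -> primitive s f df.
Proof.
move=> st [idf fE]; split; first exact: integrable_on_le idf.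
move=> u; rewrite in_itv/= => /andP[u0 us].
by rewrite fE// in_itv/= u0 (le_trans us).
Qed.

Lemma primitive_bounded_measurable t f df : 0 <= t -> primitive t f df ->
  bounded_measurable t f.
Proof.
move=> t0 [idf fE]; split.
  have cf := parameterized_integral_continuous t0 idf.
  have : measurable_fun `[0, t] (fun x => f 0 + parameterized_integral mu 0 x df).
    apply: measurable_funD => //.
    exact: subspace_continuous_measurable_fun.
  apply: eq_measurable_fun => s; rewrite inE/= => st.
  by rewrite [in RHS]fE.
exists (`|f 0| + \int[mu]_(u in `[0, t]) `|df u|) => s st.
have s_t : s <= t by move: st; rewrite in_itv/= => /andP[].
have idfs : mu.-integrable `[0, s] (EFin \o df) by exact: integrable_on_le idf.
rewrite fE// (le_trans (ler_normD _ _))// lerD2l.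
rewrite (le_trans (le_normr_Rintegral _ _))//.
rewrite Rintegral_mkcond [leRHS]Rintegral_mkcond.
apply: le_Rintegral => //.
- rewrite -restrict_EFin; apply: (integrable_mkcond _ _).1 => //.
  exact: (integrable_norm idfs).
- rewrite -restrict_EFin; apply: (integrable_mkcond _ _).1 => //.
  exact: (integrable_norm idf).
move=> u _; rewrite !patchE !mem_setE !in_itv/=.
have [us|us] := leP u s; first by rewrite (le_trans us s_t).
by rewrite andbF /=; case: (_ && _); [exact: normr_ge0|exact: lexx].
Qed.

Lemma primitive_cst t c : primitive t (fun=> c) (fun=> 0).
Proof.
split; first exact: integrable_on0.
by move=> s _; rewrite Rintegral_cst// mul0r addr0.
Qed.

Lemma primitiveD t f df g dg : primitive t f df -> primitive t g dg ->
  primitive t (fun s => f s + g s) (fun s => df s + dg s).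
Proof.
move=> [idf fE] [idg gE]; split; first exact: integrable_onD.
move=> s st; rewrite fE// gE//.
have s_t : s <= t by move: st; rewrite in_itv/= => /andP[].
rewrite RintegralD//; first ring.
  exact: integrable_on_le idf.
exact: integrable_on_le idg.
Qed.

Lemma primitiveN t f df : primitive t f df ->
  primitive t (fun s => - f s) (fun s => - df s).
Proof.
move=> [idf fE]; split; first exact: integrable_onN.
move=> s st; rewrite fE//.
have s_t : s <= t by move: st; rewrite in_itv/= => /andP[].
rewrite (_ : (fun u => - df u) = (fun u => -1 * df u)); last first.
  by apply/funext => u; rewrite mulN1r.
rewrite RintegralZl//; first ring.
exact: integrable_on_le idf.
Qed.

Lemma primitive_sum t (I : Type) (r : seq I) (f df : I -> R -> R) :
  (forall i, primitive t (f i) (df i)) ->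
  primitive t (fun s => \sum_(i <- r) f i s) (fun s => \sum_(i <- r) df i s).
Proof.
move=> fdf; elim: r => [|i r IH].
  have := primitive_cst t 0; congr primitive; apply/funext => s;
  by rewrite big_nil.
have := primitiveD (fdf i) IH; congr primitive; apply/funext => s;
by rewrite big_cons.
Qed.

(** Expand [f = f 0 + int df] in [f * dg] and [g = g s - int dg] in [df * g]: the
    two iterated integrals that appear agree by [integral_triangle]. *)
Lemma primitiveM t f df g dg : 0 <= t -> primitive t f df -> primitive t g dg ->
  primitive t (fun s => f s * g s) (fun s => df s * g s + f s * dg s).
Proof.
move=> t0 pf pg; have bf := primitive_bounded_measurable t0 pf.
have bg := primitive_bounded_measurable t0 pg.
case: (pf) (pg) => idf fE [idg gE].
have idfg : integrable_on t (fun s => df s * g s) by exact: integrable_on_mulr.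
have ifdg : integrable_on t (fun s => f s * dg s) by exact: integrable_on_mull.
split=> [|s st]; first exact: integrable_onD.
have [s0 s_t] : 0 <= s /\ s <= t by move: st; rewrite in_itv/= => /andP[].
have sidf := integrable_on_le s_t idf; have sidg := integrable_on_le s_t idg.
rewrite RintegralD//; [|exact: integrable_on_le idfg|exact: integrable_on_le ifdg].
have in_t u : u \in `[0, s] -> u \in `[0, t].
  by rewrite !in_itv/= => /andP[-> us]; rewrite (le_trans us).
have -> : \int[mu]_(u in `[0, s]) (f u * dg u) =
    f 0 * \int[mu]_(u in `[0, s]) dg u +
    \int[mu]_(v in `[0, s]) (\int[mu]_(u in `[0, v]) df u * dg v).
  rewrite -RintegralZl// -RintegralD//.
  - apply: eq_Rintegral => u; rewrite inE/= => us.
    by rewrite (fE u (in_t _ us)); ring.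
  - by apply: integrable_on_mull => //; exact: bounded_measurable_cst.
  - apply: (@eq_integrable _ _ _ mu `[0, s] _
      (EFin \o (fun u => f u * dg u - f 0 * dg u))) => //.
      move=> u; rewrite inE/= => us; congr EFin.
      by rewrite (fE u (in_t _ us)); ring.
    apply: integrable_onD; first exact: integrable_on_le ifdg.
    apply: integrable_onN; apply: integrable_on_mull => //.
    exact: bounded_measurable_cst.
rewrite -integral_triangle//.
have -> : \int[mu]_(u in `[0, s]) (df u * \int[mu]_(v in `[u, s]) dg v) =
    \int[mu]_(u in `[0, s]) (g s * df u - df u * g u).
  apply: eq_Rintegral => u; rewrite inE/= => us.
  rewrite (gE u (in_t _ us)) (gE s st).
  have [u0 u_s] : 0 <= u /\ u <= s by move: us; rewrite in_itv/= => /andP[].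
  (* Subtracting the integral over [[0, u]] leaves the half-open ]u, s]. *)
  have <- : \int[mu]_(v in `]u, s]) dg v = \int[mu]_(v in `[u, s]) dg v.
    rewrite Rintegral_itv_obnd_cbnd//.
    apply: integrableS sidg => //; apply: subset_itvr.
    by rewrite bnd_simp.
  by rewrite -(Rintegral_itvB (a := BLeft 0) (x := u))//; ring.
rewrite RintegralB//; last 2 first.
- by apply: integrable_on_mull => //; exact: bounded_measurable_cst.
- exact: integrable_on_le idfg.
rewrite RintegralZl// (fE s st) (gE s st); ring.
Qed.

End Primitives.
(** * Recognizing primitives *)

Section PrimitiveCriteria.
Context {R : realType}.
Notation mu := (@lebesgue_measure R).
Implicit Types (t s : R) (f g df dg : R -> R).

Lemma primitive_ae t f df df' : integrable_on t df' ->
  {ae mu, forall s, s \in `]0, t[ -> df s = df' s} ->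
  primitive t f df -> primitive t f df'.
Proof.
move=> idf' dfdf' [idf fE]; split=> // s st; rewrite fE//; congr (_ + _).
have s_t : s <= t by move: st; rewrite in_itv/= => /andP[].
have cc_oo h : integrable_on t h ->
    (\int[mu]_(u in `[0%R, s]) (h u)%:E = \int[mu]_(u in `]0%R, s[) (h u)%:E)%E.
  move=> /(integrable_on_le s_t)/integrable_on_measurable mh.
  rewrite -integral_itv_bndo_bndc; last first.
    apply/measurable_EFinP; apply: measurable_funS mh => //.
    by apply: subset_itvl; rewrite bnd_simp.
  rewrite -integral_itv_obnd_cbnd//; apply/measurable_EFinP.
  by apply: measurable_funS mh => //; exact: subset_itv_oo_cc.
congr fine; rewrite !cc_oo//; apply: ae_eq_integral => //.
- apply/measurable_EFinP.
  apply: measurable_funS (integrable_on_measurable idf) => //.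
  by apply: subset_itv; rewrite bnd_simp.
- apply/measurable_EFinP.
  apply: measurable_funS (integrable_on_measurable idf') => //.
  by apply: subset_itv; rewrite bnd_simp.
case: dfdf' => N [mN N0 subN]; exists N; split => // u ndf.
apply: subN => /= dfu; apply: ndf => us; rewrite dfu//.
by move: us; rewrite /= !in_itv/= => /andP[-> us]; rewrite (lt_le_trans us).
Qed.

Lemma eq_primitive t f df df' : (forall s, s \in `[0, t] -> df s = df' s) ->
  primitive t f df -> primitive t f df'.
Proof.
move=> dfdf' [idf fE]; split.
  by apply: eq_integrable idf => // s; rewrite inE/= => st; rewrite /= dfdf'.
move=> s st; rewrite fE//; congr (_ + _); apply: eq_Rintegral => u.
rewrite inE/= => us; apply: dfdf'; move: us st; rewrite !in_itv/=.
by move=> /andP[-> us] /andP[_]; exact: le_trans.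
Qed.

(** Continuity of the derivative up to the endpoints lets the fundamental theorem
    of calculus apply on each [[0, s]]. *)
Lemma derivative_primitive t f df :
  {within `[0, t], continuous f} -> {within `[0, t], continuous df} ->
  (forall s, s \in `]0, t[ -> is_derive s 1 f (df s)) -> primitive t f df.
Proof.
move=> cf cdf dfE; split.
  by apply: continuous_compact_integrable => //; exact: segment_compact.
move=> s; rewrite in_itv/= le_eqVlt => /andP[/predU1P[<- _|s0 s_t]].
  by rewrite set_itv1 Rintegral_set1 addr0.
have sub : `[0, s] `<=` `[0, t] by apply: subset_itvl; rewrite bnd_simp.
have /(continuous_within_itvP _ s0)[_ f0 fs] := continuous_subspaceW sub cf.
have in_t u : u \in `]0, s[ -> u \in `]0, t[.
  by rewrite !in_itv/= => /andP[-> us]; rewrite (lt_le_trans us).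
rewrite /Rintegral (@continuous_FTC2 _ df f)//=; first ring.
- exact: continuous_subspaceW cdf.
- by split=> // u us; have [] := dfE u (in_t _ us).
- by move=> u us; rewrite derive1E; have [_] := dfE u (in_t _ us).
Qed.

End PrimitiveCriteria.

(** * Matrix-valued functions *)

Section Entrywise.
Context {R : realType}.
Implicit Types (K : (R -> R) -> Prop) (t : R).

Definition entrywise K p q (F : R -> 'M[R]_(p, q)) :=
  forall i j, K (fun s => F s i j).

Lemma entrywiseD K p q (F G : R -> 'M[R]_(p, q)) :
  (forall f g, K f -> K g -> K (fun s => f s + g s)) ->
  entrywise K F -> entrywise K G -> entrywise K (fun s => F s + G s).
Proof.
move=> KD KF KG i j; have := KD _ _ (KF i j) (KG i j).
by congr K; apply/funext => s; rewrite mxE.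
Qed.

Lemma entrywiseM K1 K2 K3 p q r (F : R -> 'M[R]_(p, q)) (G : R -> 'M[R]_(q, r)) :
  K3 (fun=> 0) -> (forall f g, K3 f -> K3 g -> K3 (fun s => f s + g s)) ->
  (forall f g, K1 f -> K2 g -> K3 (fun s => f s * g s)) ->
  entrywise K1 F -> entrywise K2 G -> entrywise K3 (fun s => F s *m G s).
Proof.
move=> K30 K3D K3M K1F K2G i j.
have : K3 (fun s => \sum_(k <- index_enum 'I_q) (F s i k * G s k j)).
  elim: (index_enum 'I_q) => [|k r' IH].
    by move: K30; congr K3; apply/funext => s; rewrite big_nil.
  have := K3D _ _ (K3M _ _ (K1F i k) (K2G k j)) IH.
  by congr K3; apply/funext => s; rewrite big_cons.
by congr K3; apply/funext => s; rewrite mxE.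
Qed.

Lemma entrywise_tr K p q (F : R -> 'M[R]_(p, q)) :
  entrywise K F -> entrywise K (fun s => (F s)^T).
Proof.
by move=> KF i j; have := KF j i; congr K; apply/funext => s; rewrite mxE.
Qed.

Lemma entrywise_cst K p q (M : 'M[R]_(p, q)) :
  (forall c, K (fun=> c)) -> entrywise K (fun=> M).
Proof. by move=> Kc i j; exact: Kc. Qed.

Lemma bounded_measurable_mxD t p q (F G : R -> 'M[R]_(p, q)) :
  entrywise (bounded_measurable t) F -> entrywise (bounded_measurable t) G ->
  entrywise (bounded_measurable t) (fun s => F s + G s).
Proof. by apply: entrywiseD; exact: bounded_measurableD. Qed.

Lemma bounded_measurable_mxM t p q r
    (F : R -> 'M[R]_(p, q)) (G : R -> 'M[R]_(q, r)) :
  entrywise (bounded_measurable t) F -> entrywise (bounded_measurable t) G ->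
  entrywise (bounded_measurable t) (fun s => F s *m G s).
Proof.
apply: entrywiseM; first exact: bounded_measurable_cst.
  exact: bounded_measurableD.
exact: bounded_measurableM.
Qed.

Lemma bounded_measurable_mx_cst t p q (M : 'M[R]_(p, q)) :
  entrywise (bounded_measurable t) (fun=> M).
Proof. by apply: entrywise_cst => c; exact: bounded_measurable_cst. Qed.

Lemma square_integrable_mxD t p q (F G : R -> 'M[R]_(p, q)) :
  entrywise (square_integrable t) F -> entrywise (square_integrable t) G ->
  entrywise (square_integrable t) (fun s => F s + G s).
Proof. by apply: entrywiseD; exact: square_integrableD. Qed.

Lemma square_integrable_mxMl t p q r
    (F : R -> 'M[R]_(p, q)) (G : R -> 'M[R]_(q, r)) :
  entrywise (bounded_measurable t) F -> entrywise (square_integrable t) G ->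
  entrywise (square_integrable t) (fun s => F s *m G s).
Proof.
apply: entrywiseM.
- apply: bounded_measurable_square_integrable; exact: bounded_measurable_cst.
- exact: square_integrableD.
- exact: square_integrable_mull.
Qed.

Lemma square_integrable_mxMcl t p q r (M : 'M[R]_(p, q)) (G : R -> 'M[R]_(q, r)) :
  entrywise (square_integrable t) G ->
  entrywise (square_integrable t) (fun s => M *m G s).
Proof.
by move=> G2; apply: square_integrable_mxMl => //; exact: bounded_measurable_mx_cst.
Qed.

Lemma square_integrable_mxB t p q (F G : R -> 'M[R]_(p, q)) :
  entrywise (square_integrable t) F -> entrywise (square_integrable t) G ->
  entrywise (square_integrable t) (fun s => F s - G s).
Proof.
move=> F2 G2; have := square_integrable_mxD F2 (square_integrable_mxMcl (- 1%:M) G2).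
by under eq_fun do rewrite mulNmx mul1mx.
Qed.

Lemma integrable_mxM t p q r
    (F : R -> 'M[R]_(p, q)) (G : R -> 'M[R]_(q, r)) :
  entrywise (square_integrable t) F -> entrywise (square_integrable t) G ->
  entrywise (integrable_on t) (fun s => F s *m G s).
Proof.
apply: entrywiseM; first exact: integrable_on0.
  exact: integrable_onD.
exact: square_integrableM.
Qed.

Lemma bounded_measurable_mx_square_integrable t p q (F : R -> 'M[R]_(p, q)) :
  entrywise (bounded_measurable t) F -> entrywise (square_integrable t) F.
Proof. by move=> bF i j; exact: bounded_measurable_square_integrable. Qed.

Lemma square_integrable_mx_integrable t p q (F : R -> 'M[R]_(p, q)) :
  entrywise (square_integrable t) F -> entrywise (integrable_on t) F.
Proof. by move=> bF i j; exact: square_integrable_integrable. Qed.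

Definition mxprimitive t p q (F dF : R -> 'M[R]_(p, q)) :=
  forall i j, primitive t (fun s => F s i j) (fun s => dF s i j).

Lemma mxprimitive_le t s p q (F dF : R -> 'M[R]_(p, q)) : s <= t ->
  mxprimitive t F dF -> mxprimitive s F dF.
Proof. by move=> st pF i j; exact: primitive_le (pF i j). Qed.

Lemma mxprimitive_bounded t p q (F dF : R -> 'M[R]_(p, q)) : 0 <= t ->
  mxprimitive t F dF -> entrywise (bounded_measurable t) F.
Proof. by move=> t0 pF i j; exact: primitive_bounded_measurable (pF i j). Qed.

Lemma eq_mxprimitive t p q (F dF dF' : R -> 'M[R]_(p, q)) :
  (forall s, s \in `[0, t] -> dF s = dF' s) ->
  mxprimitive t F dF -> mxprimitive t F dF'.
Proof.
move=> dFE pF i j; apply: eq_primitive (pF i j) => s st.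
by rewrite dFE.
Qed.

Lemma mxprimitiveD t p q (F dF G dG : R -> 'M[R]_(p, q)) :
  mxprimitive t F dF -> mxprimitive t G dG ->
  mxprimitive t (fun s => F s + G s) (fun s => dF s + dG s).
Proof.
move=> pF pG i j; have := primitiveD (pF i j) (pG i j).
by congr primitive; apply/funext => s; rewrite mxE.
Qed.

Lemma mxprimitiveN t p q (F dF : R -> 'M[R]_(p, q)) :
  mxprimitive t F dF -> mxprimitive t (fun s => - F s) (fun s => - dF s).
Proof.
move=> pF i j; have := primitiveN (pF i j).
by congr primitive; apply/funext => s; rewrite mxE.
Qed.

Lemma mxprimitiveB t p q (F dF G dG : R -> 'M[R]_(p, q)) :
  mxprimitive t F dF -> mxprimitive t G dG ->
  mxprimitive t (fun s => F s - G s) (fun s => dF s - dG s).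
Proof. by move=> pF /mxprimitiveN; exact: mxprimitiveD. Qed.

Lemma mxprimitive_cst t p q (M : 'M[R]_(p, q)) :
  mxprimitive t (fun=> M) (fun=> 0).
Proof.
move=> i j; have := primitive_cst t (M i j).
by congr primitive; apply/funext => s; rewrite mxE.
Qed.

Lemma mxprimitive_tr t p q (F dF : R -> 'M[R]_(p, q)) :
  mxprimitive t F dF -> mxprimitive t (fun s => (F s)^T) (fun s => (dF s)^T).
Proof.
move=> pF i j; have := pF j i.
by congr primitive; apply/funext => s; rewrite mxE.
Qed.

Lemma mxprimitiveM t p q r (F dF : R -> 'M[R]_(p, q))
    (G dG : R -> 'M[R]_(q, r)) : 0 <= t ->
  mxprimitive t F dF -> mxprimitive t G dG ->
  mxprimitive t (fun s => F s *m G s) (fun s => dF s *m G s + F s *m dG s).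
Proof.
move=> t0 pF pG i j; have := primitive_sum (index_enum 'I_q)
  (fun k => primitiveM t0 (pF i k) (pG k j)).
congr primitive; apply/funext => s; first by rewrite mxE.
by rewrite big_split !mxE.
Qed.

Lemma mxprimitiveMl t p q r (M : 'M[R]_(p, q)) (G dG : R -> 'M[R]_(q, r)) :
  0 <= t -> mxprimitive t G dG ->
  mxprimitive t (fun s => M *m G s) (fun s => M *m dG s).
Proof.
move=> t0 pG; apply: eq_mxprimitive (mxprimitiveM t0 (mxprimitive_cst t M) pG).
by move=> s _; rewrite mul0mx add0r.
Qed.

Lemma mxprimitiveMr t p q r (F dF : R -> 'M[R]_(p, q)) (M : 'M[R]_(q, r)) :
  0 <= t -> mxprimitive t F dF ->
  mxprimitive t (fun s => F s *m M) (fun s => dF s *m M).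
Proof.
move=> t0 pF; apply: eq_mxprimitive (mxprimitiveM t0 pF (mxprimitive_cst t M)).
by move=> s _; rewrite mulmx0 addr0.
Qed.

Lemma mxprimitive_eq0 t p q (F dF : R -> 'M[R]_(p, q)) :
  mxprimitive t F dF -> (forall s, s \in `[0, t] -> dF s = 0) ->
  forall s, s \in `[0, t] -> F s = F 0.
Proof.
move=> pF dF0 s st; apply/matrixP => i j.
have [_ /(_ _ st) ->] := eq_mxprimitive (dF' := fun=> 0) dF0 pF i j.
by rewrite [X in Rintegral _ _ (fun=> X)]mxE Rintegral_cst// mul0r addr0.
Qed.

Lemma mxprimitive_integral t p q (dF : R -> 'M[R]_(p, q)) (M : 'M[R]_(p, q)) :
  entrywise (integrable_on t) dF ->
  mxprimitive t
    (fun s => \matrix_(i, j)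
      (M i j + \int[lebesgue_measure]_(u in `[0, s]) dF u i j)) dF.
Proof.
move=> idF i j; split=> [|s st]; first exact: idF.
by rewrite !mxE set_itv1 Rintegral_set1 addr0.
Qed.

End Entrywise.
(** * Fundamental matrix of a linear differential equation *)

Section LinearODE.
Context {R : realType}.
Notation mu := (@lebesgue_measure R).

Lemma continuous_expRM (l : R) : continuous (fun v : R => expR (l * v)).
Proof.
move=> v; apply: (@continuous_comp _ _ _ (fun v : R => l * v) expR).
  exact: mulrl_continuous.
exact: continuous_expR.
Qed.

Lemma expR_integral_le (l s : R) : 0 < l -> 0 <= s ->
  \int[mu]_(v in `[0, s]) expR (l * v) <= expR (l * s) / l.
Proof.
move=> l0 s0.
have ce : continuous (fun v : R => expR (l * v)) by exact: continuous_expRM.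
have [_ /(_ s)] : primitive s (fun v => expR (l * v)) (fun v => expR (l * v) * l).
  apply: derivative_primitive.
  - exact: continuous_subspaceT.
  - apply: continuous_subspaceT => v; apply: cvgM; [exact: ce|exact: cvg_cst].
  - move=> v _; have d1 : is_derive v 1 (fun u : R => l * u) l.
      by apply: is_derive_eq; rewrite /GRing.scale/= mulr1.
    exact: (is_derive1_comp (is_derive_expR (l * v)) d1).
rewrite in_itv/= s0 lexx mulr0 expR0 RintegralZr//; last first.
  apply: continuous_compact_integrable; first exact: segment_compact.
  exact: continuous_subspaceT.
by move=> /(_ isT) ->; rewrite ler_pdivlMr// lerDr.
Qed.

(** The terms of the Picard (Peano-Baker) series of [Z' = G Z], [Z 0 = 1]: each
    one is the integral of [G] times the previous one. *)
Fixpoint picard n (G : R -> 'M[R]_n) k : R -> 'M[R]_n :=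
  if k is k'.+1 then fun s =>
    \matrix_(i, j) \int[mu]_(v in `[0, s]) (G v *m picard G k' v) i j
  else fun=> 1%:M.

Lemma picardSE n (G : R -> 'M[R]_n) k s i j : picard G k.+1 s i j =
  \int[mu]_(v in `[0, s]) (G v *m picard G k v) i j.
Proof. by rewrite mxE. Qed.

Lemma cvg_sum_seq (I : Type) (r : seq I) (f : I -> R^nat) (l : I -> R) :
  (forall i, f i @ \oo --> l i) ->
  (\sum_(i <- r) f i k) @[k --> \oo] --> \sum_(i <- r) l i.
Proof.
move=> fl; elim: r => [|i r IH].
  rewrite big_nil; under eq_fun do rewrite big_nil; exact: cvg_cst.
rewrite big_cons; under eq_fun do rewrite big_cons.
by apply: cvgD.
Qed.

Section PicardSeries.
Context (T : R) (T0 : 0 <= T) (n : nat) (G : R -> 'M[R]_n).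
Hypothesis bG : entrywise (bounded_measurable T) G.

Lemma entrywise_bound : exists2 K, 0 < K &
  forall s, s \in `[0, T] -> forall i j, `|G s i j| <= K.
Proof.
have [M GM] : exists M : 'I_n -> 'I_n -> R,
    forall i j s, s \in `[0, T] -> `|G s i j| <= M i j.
  exists (fun i j => sval (cid (bG i j).2)) => i j.
  exact: (svalP (cid (bG i j).2)).
exists (1 + \sum_i \sum_j `|M i j|).
  by rewrite ltr_pwDl// sumr_ge0// => i _; rewrite sumr_ge0.
move=> s sT i j; rewrite (le_trans (GM i j s sT))// (le_trans (ler_norm _))//.
rewrite (bigD1 i)//= (bigD1 j)//= ler_wpDl// -addrA lerDl addr_ge0//.
  by rewrite sumr_ge0.
by rewrite sumr_ge0// => k _; rewrite sumr_ge0.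
Qed.

Lemma picard_bounded k : entrywise (bounded_measurable T) (picard G k).
Proof.
elim: k => [|k IH]; first exact: bounded_measurable_mx_cst.
have ip : entrywise (integrable_on T) (fun s => G s *m picard G k s).
  move=> i j; apply: bounded_measurable_integrable.
  exact: bounded_measurable_mxM.
have := mxprimitive_bounded T0 (mxprimitive_integral 0 ip).
by congr entrywise; apply/funext => s; apply/matrixP => i j; rewrite !mxE add0r.
Qed.

Lemma picard_primitive k :
  mxprimitive T (picard G k.+1) (fun s => G s *m picard G k s).
Proof.
have ip : entrywise (integrable_on T) (fun s => G s *m picard G k s).
  move=> i j; apply: bounded_measurable_integrable.
  by apply: bounded_measurable_mxM => //; exact: picard_bounded.
have := mxprimitive_integral 0 ip.
by congr mxprimitive; apply/funext => s; apply/matrixP => i j; rewrite !mxE add0r.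
Qed.

(** The weight [expR (l * s)] with [l] twice a bound on the norm of [G] makes the
    integral operator a contraction of ratio [1/2]: the series
    converges geometrically on the whole horizon. *)
Lemma picard_le : exists2 l, 0 < l & forall k s, s \in `[0, T] -> forall i j,
  `|picard G k s i j| <= 2^-1 ^+ k * expR (l * s).
Proof.
have [K K0 GK] := entrywise_bound.
(* [n.+1] instead of [n] keeps [l] positive for empty matrices. *)
exists (2 * (n.+1%:R * K)); first by rewrite !mulr_gt0.
have : 0 < 2 * (n.+1%:R * K) by rewrite !mulr_gt0.
move lE : (2 * _) => l l0.
elim=> [|k IH] s sT i j.
  rewrite expr0 mul1r mxE; apply: (@le_trans _ _ 1).
    by case: eqP; rewrite ?normr1 ?normr0.
  rewrite (le_trans _ (expR_ge1Dx _))// lerDl mulr_ge0 ?(ltW l0)//.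
  by move: sT; rewrite in_itv/= => /andP[].
have [s0 s_T] : 0 <= s /\ s <= T by move: sT; rewrite in_itv/= => /andP[].
have [ip _] := picard_primitive k i j.
rewrite picardSE (le_trans (le_normr_Rintegral _ _))//.
  exact: integrable_on_le ip.
have ie : integrable_on s (fun v => expR (l * v)).
  apply: continuous_compact_integrable; first exact: segment_compact.
  exact/continuous_subspaceT/continuous_expRM.
have step v : v \in `[0, s] -> `|(G v *m picard G k v) i j| <=
    n.+1%:R * K * 2^-1 ^+ k * expR (l * v).
  rewrite in_itv/= => /andP[v0 vs].
  have vT : v \in `[0, T] by rewrite in_itv/= v0 (le_trans vs).
  rewrite mxE (le_trans (ler_norm_sum _ _ _))//.
  apply: (@le_trans _ _ (\sum_(m < n) K * (2^-1 ^+ k * expR (l * v)))).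
    by apply: ler_sum => m _; rewrite normrM ler_pM// ?GK// IH.
  rewrite sumr_const card_ord -[leLHS]mulr_natl -!mulrA.
  apply: ler_wpM2r; last by rewrite ler_nat.
  by rewrite mulr_ge0 ?(ltW K0)// mulr_ge0 ?expR_ge0// exprn_ge0.
apply: (@le_trans _ _ (\int[mu]_(v in `[0, s])
    (n.+1%:R * K * 2^-1 ^+ k * expR (l * v)))).
  apply: le_Rintegral => //.
  - exact: (integrable_norm (integrable_on_le s_T ip)).
  - by apply: integrable_on_mull => //; exact: bounded_measurable_cst.
rewrite RintegralZl//.
apply: (@le_trans _ _ (n.+1%:R * K * 2^-1 ^+ k * (expR (l * s) / l))).
  apply: ler_wpM2l; last exact: expR_integral_le.
  by rewrite !mulr_ge0 ?(ltW K0)// exprn_ge0.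
rewrite exprS le_eqVlt; apply/orP; left; apply/eqP.
by rewrite -lE; field; rewrite (gt_eqF K0) addrC natr1 pnatr_eq0.
Qed.

Let partial N s := \sum_(k < N) picard G k s.

Lemma partial_primitive N :
  mxprimitive T (partial N.+1) (fun s => G s *m partial N s).
Proof.
elim: N => [|N IH].
  have := mxprimitive_cst T (1%:M : 'M[R]_n).
  congr mxprimitive; apply/funext => s; first by rewrite /partial big_ord1.
  by rewrite /partial big_ord0 mulmx0.
have := mxprimitiveD IH (picard_primitive N).
congr mxprimitive; apply/funext => s; first by rewrite /partial [RHS]big_ord_recr.
by rewrite /partial big_ord_recr mulmxDr.
Qed.

Lemma partial0 N : partial N.+1 0 = 1%:M.
Proof.
rewrite /partial big_ord_recl big1 ?addr0// => k _.
by apply/matrixP => i j; rewrite !mxE set_itv1 Rintegral_set1.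
Qed.

(** The partial sums [S_N] satisfy [S_{N+1} = 1 + int G S_N] and are bounded
    uniformly in [N]; dominated convergence passes to the limit in the integral. *)
Theorem fundamental_matrix :
  exists2 Z : R -> 'M[R]_n, Z 0 = 1%:M & mxprimitive T Z (fun s => G s *m Z s).
Proof.
have [l l0 ple] := picard_le.
have [K K0 GK] := entrywise_bound.
have geom_cvg s : cvgn (series (geometric (expR (l * s)) (2^-1 : R))).
  by apply: is_cvg_geometric_series; rewrite ger0_norm; lra.
have partialE N s i j : partial N s i j = series (fun k => picard G k s i j) N.
  by rewrite /partial summxE /series /= big_mkord.
have part_cvg s i j : s \in `[0, T] ->
    cvgn (fun N => partial N s i j).
  move=> sT; under eq_fun do rewrite partialE.
  apply: normed_cvg; apply: series_le_cvg (geom_cvg s) => k /=.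
  - exact: normr_ge0.
  - by rewrite mulr_ge0 ?expR_ge0// exprn_ge0.
  - by rewrite mulrC ple.
have part_le N s i j : s \in `[0, T] -> `|partial N s i j| <= 2 * expR (l * T).
  move=> sT; rewrite partialE /series /= (le_trans (ler_norm_sum _ _ _))//.
  apply: (@le_trans _ _ (series (geometric (expR (l * T)) (2^-1 : R)) N)).
    rewrite /series /= ler_sum// => k _; rewrite mulrC (le_trans (ple k s sT i j))//.
    apply: ler_wpM2l; first by rewrite exprn_ge0.
    rewrite ler_expR; apply: ler_wpM2l; first exact: ltW.
    by move: sT; rewrite in_itv/= => /andP[].
  rewrite (le_trans (geometric_le_lim _ _ _ _))// ?expR_ge0//.
    by rewrite ger0_norm; lra.
  rewrite mulrC; apply: ler_wpM2r; first exact: expR_ge0.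
  by rewrite (_ : 1 - 2^-1 = 2^-1) ?invrK//; lra.
pose Z s : 'M[R]_n := \matrix_(i, j) limn (fun N => partial N s i j).
have Zcvg s i j : s \in `[0, T] -> (fun N => partial N s i j) @ \oo --> Z s i j.
  by move=> sT; rewrite mxE; exact: part_cvg.
have Z0 : Z 0 = 1%:M.
  apply/matrixP => i j; rewrite mxE; apply/cvg_lim => //.
  rewrite -cvg_shiftS /=; under eq_fun do rewrite partial0; exact: cvg_cst.
exists Z => // i j.
pose C := n%:R * (K * (2 * expR (l * T))).
pose f_ N s := ((G s *m partial N s) i j)%:E.
pose f s := ((G s *m Z s) i j)%:E.
have ip N : integrable_on T (fun s => (G s *m partial N s) i j).
  by have [] := partial_primitive N i j.
have ff s : s \in `[0, T] -> f_ ^~ s @ \oo --> f s.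
  move=> sT; apply: cvg_EFin; first exact: nearW.
  rewrite /f_ /f /= /comp/=.
  rewrite mxE; under eq_fun do rewrite mxE.
  by apply: cvg_sum_seq => k; apply: cvgM; [exact: cvg_cst|exact: Zcvg].
have fC N s : s \in `[0, T] -> (`|f_ N s| <= C%:E)%E.
  move=> sT; rewrite lee_fin mxE (le_trans (ler_norm_sum _ _ _))//.
  apply: (@le_trans _ _ (\sum_(m < n) K * (2 * expR (l * T)))).
    by apply: ler_sum => k _; rewrite normrM ler_pM// ?GK ?part_le.
  by rewrite sumr_const card_ord -[leLHS]mulr_natl lexx.
have intC : integrable_on T (fun=> C).
  by apply: bounded_measurable_integrable; exact: bounded_measurable_cst.
have dct s : s <= T -> mu.-integrable `[0, s] f /\
    (\int[mu]_(v in `[0%R, s]) f_ N v)%E @[N --> \oo]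
     --> (\int[mu]_(v in `[0%R, s]) f v)%E.
  move=> s_T; have in_T v : `[0, s]%classic v -> v \in `[0, T].
    by rewrite /= !in_itv/= => /andP[-> vs]; rewrite (le_trans vs).
  have mf_ N : measurable_fun `[0, s] (f_ N).
    by have := integrable_on_le s_T (ip N); exact: measurable_int.
  have [|||||? _ ?] := @dominated_convergence _ _ _ mu `[0, s]
    (measurable_itv _) f_ f (fun=> C%:E) => //.
  - by apply: (emeasurable_fun_cvg f_ f) => // v vs; apply: ff; exact: in_T.
  - by apply: aeW => v vs; apply: ff; exact: in_T.
  - exact: integrable_on_le intC.
  - by apply: aeW => v N vs; apply: fC; exact: in_T.
split; first by have [] := dct T (lexx _).
move=> s sT.
have [fi fcvg] : _ /\ _ := dct s ltac:(by move: sT; rewrite in_itv/= => /andP[]).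
have Zs := Zcvg s i j sT; rewrite -cvg_shiftS /= in Zs.
apply: (cvg_unique _ Zs) => //.
rewrite Z0 (_ : (fun N => partial N.+1 s i j) =
    (fun N => 1%:M i j + fine (\int[mu]_(v in `[0%R, s]) f_ N v)%E)); last first.
  apply/funext => N; have [_ /(_ _ sT) ->] := partial_primitive N i j.
  by rewrite partial0.
apply: cvgD; first exact: cvg_cst.
by apply: fine_cvg; rewrite fineK//; exact: integrable_fin_num fi.
Qed.

End PicardSeries.
End LinearODE.
(** * Positive definite quadratic forms and their minimizers *)

Section QuadraticForms.
Context {R : realType}.

Lemma mxD_entry p q (M N : 'M[R]_(p, q)) i j : (M + N) i j = M i j + N i j.
Proof. by rewrite mxE. Qed.

Lemma mxN_entry p q (M : 'M[R]_(p, q)) i j : (- M) i j = - M i j.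
Proof. by rewrite mxE. Qed.

Lemma mx0_entry p q i j : (0 : 'M[R]_(p, q)) i j = 0.
Proof. by rewrite mxE. Qed.

Lemma trmxD p q (M N : 'M[R]_(p, q)) : (M + N)^T = M^T + N^T.
Proof. exact: linearD. Qed.

Lemma trmxN p q (M : 'M[R]_(p, q)) : (- M)^T = - M^T.
Proof. exact: linearN. Qed.

(** Normal form of a matrix expression as a signed sum of left-associated
    products of possibly transposed factors. *)
Definition mxexpand := (mulmxDl, mulmxDr, mulmxN, mulNmx,
  @trmx_mul, trmxD, trmxN, @trmxK, mulmxA).

Lemma sqnormD n (M : 'M[R]_n) (a b : 'cV[R]_n) : M^T = M ->
  sqnorm M (a + b) = sqnorm M a + sqnorm M b + 2 * (a^T *m M *m b) 0 0.
Proof.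
move=> Ms; have ba : (b^T *m M *m a) 0 0 = (a^T *m M *m b) 0 0.
  by rewrite -[in LHS](trmxK (b^T *m M *m a)) mxE !mxexpand Ms.
by rewrite /sqnorm !mxexpand !mxD_entry ba; ring.
Qed.

Lemma sqnorm0 n (M : 'M[R]_n) : sqnorm M 0 = 0.
Proof. by rewrite /sqnorm mulmx0 mxE. Qed.

Lemma spd_ge0 n (M : 'M[R]_n) z : spd M -> 0 <= sqnorm M z.
Proof.
by move=> [_ Mp]; have [->|/Mp/ltW//] := eqVneq z 0; rewrite sqnorm0.
Qed.

Lemma spd_unit n (M : 'M[R]_n) : spd M -> M \in unitmx.
Proof.
move=> [Ms Mp]; rewrite -row_free_unit -kermx_eq0; apply/rowV0P => v /sub_kermxP vM.
apply/eqP/contraT => v0; have := Mp v^T.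
by rewrite trmx_eq0 /sqnorm trmxK vM mul0mx mxE ltxx; exact.
Qed.

Lemma spd_inv n (M : 'M[R]_n) : spd M -> spd (invmx M).
Proof.
move=> sM; have uM := spd_unit sM; case: sM => Ms Mp.
split=> [|z z0]; first by rewrite trmx_inv Ms.
have := Mp (invmx M *m z); rewrite /sqnorm trmx_mul trmx_inv Ms !mulmxA.
rewrite mulmxKV//; apply; apply: contra z0 => /eqP Mz.
by rewrite -(mulKVmx uM z) Mz mulmx0.
Qed.

Lemma sqnorm_sum n (K : Type) (r : seq K) (M : K -> 'M[R]_n) z :
  sqnorm (\sum_(s <- r) M s) z = \sum_(s <- r) sqnorm (M s) z.
Proof. by rewrite /sqnorm mulmx_sumr mulmx_suml summxE. Qed.

Lemma spd_sum n (K : eqType) (r : seq K) (M : K -> 'M[R]_n) :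
  r != [::] -> (forall s, s \in r -> spd (M s)) -> spd (\sum_(s <- r) M s).
Proof.
move=> r0 Mspd; split.
  rewrite raddf_sum /= big_seq [RHS]big_seq.
  by apply: eq_bigr => s /Mspd[].
case: r r0 Mspd => // s r _ Mspd z z0.
rewrite sqnorm_sum big_cons.
rewrite ltr_pwDl//; first by have [_] := Mspd s (mem_head _ _); exact.
rewrite big_seq sumr_ge0// => u ur; apply: spd_ge0; apply: Mspd.
by rewrite inE ur orbT.
Qed.

Definition weighted_mean n (K : Type) (r : seq K) (P : K -> 'M[R]_n)
    (x : K -> 'cV[R]_n) : 'cV[R]_n :=
  invmx (\sum_(s <- r) P s) *m \sum_(s <- r) P s *m x s.

(** Completing the square: with [z - x s = (z - mean) + (mean - x s)], the cross
    terms add up to [(z - mean)^T (calP mean - sum P x)], which is zero by the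
    choice of the mean. *)
Lemma sum_sqnorm_weighted_mean n (K : eqType) (r : seq K) (P : K -> 'M[R]_n)
    (x : K -> 'cV[R]_n) z :
  r != [::] -> (forall s, s \in r -> spd (P s)) ->
  \sum_(s <- r) sqnorm (P s) (z - x s) =
  \sum_(s <- r) sqnorm (P s) (weighted_mean r P x - x s) +
  sqnorm (\sum_(s <- r) P s) (z - weighted_mean r P x).
Proof.
move=> r0 Pspd; set xi := weighted_mean r P x.
have cross : \sum_(s <- r) ((z - xi)^T *m P s *m (xi - x s)) 0 0 = 0.
  rewrite -summxE.
  under eq_bigr do rewrite -mulmxA mulmxBr.
  rewrite -mulmx_sumr sumrB -mulmx_suml /xi /weighted_mean.
  by rewrite mulKVmx ?subrr ?mulmx0 ?mxE// spd_unit//; exact: spd_sum.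
transitivity (\sum_(s <- r) (sqnorm (P s) (xi - x s) + (sqnorm (P s) (z - xi) +
    2 * ((z - xi)^T *m P s *m (xi - x s)) 0 0))).
  rewrite big_seq [RHS]big_seq; apply: eq_bigr => s /Pspd[Ps _].
  have -> : z - x s = (z - xi) + (xi - x s) by rewrite addrA subrK.
  by rewrite [LHS]sqnormD//; ring.
by rewrite !big_split/= -mulr_sumr cross mulr0 addr0 sqnorm_sum.
Qed.

End QuadraticForms.

Section Argmin.
Context {R : realType}.

Lemma argmin_eq n (f : 'cV[R]_n -> R) (xi : 'cV[R]_n) :
  is_minimizer f xi -> (forall z, is_minimizer f z -> z = xi) ->
  argmin f = xi.
Proof.
move=> fxi funi; rewrite /argmin; case: xgetP => [z _ /funi//|].
by move=> /(_ xi).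
Qed.

Lemma quadratic_minimizer n (f : 'cV[R]_n -> R) (P : 'M[R]_n) (a : R) xi :
  0 < a -> spd P -> (forall z, f z = f xi + a * sqnorm P (z - xi)) ->
  is_minimizer f xi /\ forall z, is_minimizer f z -> z = xi.
Proof.
move=> a0 sP fE; split=> [z|z fz].
  by rewrite (fE z) lerDl mulr_ge0 ?(ltW a0)// spd_ge0.
apply/eqP; rewrite -subr_eq0; apply/contraT => /(sP.2).
have := fz xi; rewrite (fE z) gerDl pmulr_rle0// => h1 h2.
by have := lt_le_trans h2 h1; rewrite ltxx.
Qed.

End Argmin.
(** After expansion the matrix products are treated as atoms: an identity of
    signed sums holds entry by entry in the commutative ring of scalars. *)
Ltac mxring := rewrite ?mxexpand; apply/matrixP => ? ?;
  rewrite ?(mxD_entry, mxN_entry, mx0_entry); ring.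

(** * Transition matrices *)

Section Transition.
Context {R : realType}.

(** [Y] is obtained by transposing the fundamental matrix of [- G^T]; then
    [(Y Z)' = - Y G Z + Y G Z = 0], so [Y Z = 1] throughout. *)
Lemma transition_matrices T n (G : R -> 'M[R]_n) : 0 <= T ->
  entrywise (bounded_measurable T) G ->
  exists Z Y : R -> 'M[R]_n,
  [/\ Z 0 = 1%:M, Y 0 = 1%:M,
      mxprimitive T Z (fun s => G s *m Z s),
      mxprimitive T Y (fun s => - (Y s *m G s)) &
      forall s, s \in `[0, T] -> Y s *m Z s = 1%:M /\ Z s *m Y s = 1%:M].
Proof.
move=> T0 bG; have [Z Z0 pZ] := fundamental_matrix T0 bG.
have bGT : entrywise (bounded_measurable T) (fun s => - 1%:M *m (G s)^T).
  apply: bounded_measurable_mxM; first exact: bounded_measurable_mx_cst.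
  exact: entrywise_tr.
have [W W0 pW] := fundamental_matrix T0 bGT.
have pY : mxprimitive T (fun s => (W s)^T) (fun s => - ((W s)^T *m G s)).
  apply: eq_mxprimitive (mxprimitive_tr pW) => s _.
  by rewrite mulNmx mul1mx mulNmx trmxN trmx_mul trmxK.
exists Z, (fun s => (W s)^T); split=> //; first by rewrite W0 trmx1.
move=> s sT; suff YZ : (W s)^T *m Z s = 1%:M by split=> //; exact: mulmx1C.
rewrite (mxprimitive_eq0 (mxprimitiveM T0 pY pZ) _ sT) ?W0 ?Z0 ?trmx1 ?mul1mx//.
by move=> u _; rewrite mulNmx !mulmxA addNr.
Qed.

Lemma within_continuous_cst (t c : R) :
  {within `[0, t], continuous (fun _ : R => c)}.
Proof. by move=> x; exact: cvg_cst. Qed.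

Lemma within_continuousD (t : R) (f g : R -> R) :
  {within `[0, t], continuous f} -> {within `[0, t], continuous g} ->
  {within `[0, t], continuous (fun s => f s + g s)}.
Proof. by move=> cf cg x; apply: cvgD; [exact: cf|exact: cg]. Qed.

Lemma within_continuousM (t : R) (f g : R -> R) :
  {within `[0, t], continuous f} -> {within `[0, t], continuous g} ->
  {within `[0, t], continuous (fun s => f s * g s)}.
Proof. by move=> cf cg x; apply: cvgM; [exact: cf|exact: cg]. Qed.

Definition mxcontinuous (t : R) p q (F : R -> 'M[R]_(p, q)) :=
  entrywise (fun f : R -> R => {within `[0, t], continuous f}) F.

Lemma mxcontinuous_cst t p q (M : 'M[R]_(p, q)) : mxcontinuous t (fun=> M).
Proof. by apply: entrywise_cst => c; exact: within_continuous_cst. Qed.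

Lemma mxcontinuousD t p q (F G : R -> 'M[R]_(p, q)) :
  mxcontinuous t F -> mxcontinuous t G -> mxcontinuous t (fun s => F s + G s).
Proof. by apply: entrywiseD => f g; exact: within_continuousD. Qed.

Lemma mxcontinuousM t p q r (F : R -> 'M[R]_(p, q)) (G : R -> 'M[R]_(q, r)) :
  mxcontinuous t F -> mxcontinuous t G -> mxcontinuous t (fun s => F s *m G s).
Proof.
apply: entrywiseM; first exact: within_continuous_cst.
  by move=> f g; exact: within_continuousD.
by move=> f g; exact: within_continuousM.
Qed.

Lemma within_continuous_entries (t : R) p q (F : R -> 'M[R]_(p, q)) :
  {within `[0, t], continuous F} -> mxcontinuous t F.
Proof.
move=> cF i j x.
exact: (@cvg_comp _ _ _ F (fun M : 'M[R]_(p, q) => M i j) _ _ _ (cF x)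
  (@coord_continuous _ _ _ i j (F x))).
Qed.

Lemma is_derive_entries p q (F : R -> 'M[R]_(p, q)) (s : R)
    (dF : 'M[R]_(p, q)) i j :
  is_derive s 1 F dF -> is_derive s 1 (fun u : R => F u i j) (dF i j).
Proof.
move=> [Fs FE]; split; first by have /derivable_mxP := Fs; exact.
by rewrite -FE derive_mx// mxE.
Qed.

End Transition.

(** * The Riccati equation *)

Section Riccati.
Context {R : realType} (T : R) (n m r : nat) (A Gam : 'M[R]_n) (Rm : 'M[R]_m).
Context (Q : 'M[R]_r) (B : 'M[R]_(n, m)) (C : 'M[R]_(r, n)) (Pi : R -> 'M[R]_n).
Hypotheses (T0 : 0 <= T) (Gam_spd : spd Gam) (Rm_spd : spd Rm) (Q_spd : spd Q).
Hypothesis Pi_sol : riccati_solution T A Gam Rm Q B C Pi.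

Let S := C^T *m invmx Q *m C.

Lemma sensor_symm : S^T = S.
Proof. by have [Qs _] := spd_inv Q_spd; rewrite /S !mxexpand Qs. Qed.

Lemma riccati_primitive : mxprimitive T Pi (fun s =>
  A *m Pi s + Pi s *m A^T - Pi s *m S *m Pi s + B *m Rm *m B^T).
Proof.
have [cPi dPi _] := Pi_sol.
have c1 := within_continuous_entries cPi.
move=> i j; apply: derivative_primitive.
- exact: c1.
- have c2 : mxcontinuous T (fun s =>
      A *m Pi s + Pi s *m A^T - Pi s *m S *m Pi s + B *m Rm *m B^T).
    rewrite (_ : (fun s => _) = (fun s => A *m Pi s + Pi s *m A^T
      + (- 1%:M) *m (Pi s *m S *m Pi s) + B *m Rm *m B^T)); last first.
      by apply/funext => s; rewrite mulNmx mul1mx.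
    apply: mxcontinuousD; last exact: mxcontinuous_cst.
    apply: mxcontinuousD; first apply: mxcontinuousD.
    - by apply: mxcontinuousM => //; exact: mxcontinuous_cst.
    - by apply: mxcontinuousM => //; exact: mxcontinuous_cst.
    - apply: mxcontinuousM; first exact: mxcontinuous_cst.
      apply: mxcontinuousM => //; apply: mxcontinuousM => //.
      exact: mxcontinuous_cst.
  exact: c2.
- move=> s sT; have := is_derive_entries i j (dPi s sT).
  by rewrite /S !mulmxA.
Qed.

Lemma riccati_bounded : entrywise (bounded_measurable T) Pi.
Proof. exact: mxprimitive_bounded riccati_primitive. Qed.

(** The closed-loop matrix: the Riccati equation reads
    [Pi' = F Pi + Pi F^T + Pi S Pi + B R B^T] for symmetric [Pi]. *)
Let F s := A - Pi s *m S.

Lemma closed_loop_bounded : entrywise (bounded_measurable T) F.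
Proof.
have : entrywise (bounded_measurable T) (fun s => A + Pi s *m (- S)).
  apply: bounded_measurable_mxD; first exact: bounded_measurable_mx_cst.
  apply: bounded_measurable_mxM; first exact: riccati_bounded.
  exact: bounded_measurable_mx_cst.
by rewrite /F; under eq_fun do rewrite mulmxN.
Qed.

(** [D = Pi - Pi^T] satisfies the linear equation [D' = F D + D F^T], so that
    [Y D Y^T] is constant when [Y' = - Y F]; it is zero at time [0]. *)
Lemma riccati_symm s : s \in `[0, T] -> (Pi s)^T = Pi s.
Proof.
move=> sT; have [Z [Y [_ Y0 _ pY YZ]]] := transition_matrices T0 closed_loop_bounded.
have pD := mxprimitiveB riccati_primitive (mxprimitive_tr riccati_primitive).
have pYDY := mxprimitiveM T0 (mxprimitiveM T0 pY pD) (mxprimitive_tr pY).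
have YDY0 : Y s *m (Pi s - (Pi s)^T) *m (Y s)^T = 0.
  rewrite (mxprimitive_eq0 pYDY _ sT).
    have [_ _ ->] := Pi_sol; have [Gs _] := Gam_spd.
    by rewrite Gs subrr mulmx0 mul0mx.
  have [Rs _] := Rm_spd.
  move=> u _; rewrite /F; move: (S) sensor_symm => W Ws.
  by rewrite !mxexpand Ws Rs; mxring.
have [ZY YZs] := YZ s sT.
apply/eqP; rewrite eq_sym -subr_eq0; apply/eqP.
have : Z s *m (Y s *m (Pi s - (Pi s)^T) *m (Y s)^T) *m (Z s)^T = 0.
  by rewrite YDY0 mulmx0 mul0mx.
rewrite !mulmxA YZs mul1mx -mulmxA -trmx_mul YZs trmx1 mulmx1.
exact.
Qed.

(** The derivative of [Y Pi Y^T] is [Y (Pi S Pi + B R B^T) Y^T], a positive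
    semidefinite matrix, and its initial value is [Gam]. *)
Lemma riccati_lower_bound (Y : R -> 'M[R]_n) : Y 0 = 1%:M ->
  mxprimitive T Y (fun s => - (Y s *m F s)) ->
  forall z s, s \in `[0, T] -> sqnorm Gam z <= sqnorm (Pi s) ((Y s)^T *m z).
Proof.
move=> Y0 pY z s sT.
have pYPY := mxprimitiveM T0 (mxprimitiveM T0 pY riccati_primitive)
  (mxprimitive_tr pY).
have pz := mxprimitiveMr z T0 (mxprimitiveMl z^T T0 pYPY).
have {pYPY}pz : mxprimitive T
    (fun s => z^T *m (Y s *m Pi s *m (Y s)^T) *m z)
    (fun s => z^T *m (Y s *m (Pi s *m S *m Pi s + B *m Rm *m B^T) *m (Y s)^T) *m z).
  apply: eq_mxprimitive pz => u uT; congr (_ *m _ *m _).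
  have Pis := riccati_symm uT.
  rewrite /F; move: (S) sensor_symm => W Ws.
  by rewrite !mxexpand Ws Pis; mxring.
have [_ /(_ s sT) hs] := pz 0 0.
have -> : sqnorm (Pi s) ((Y s)^T *m z) =
    (z^T *m (Y s *m Pi s *m (Y s)^T) *m z) 0 0.
  by rewrite /sqnorm !mxexpand.
have [_ _ Pi0] := Pi_sol.
rewrite hs Y0 mul1mx trmx1 mulmx1 Pi0 lerDl Rintegral_ge0// => u uT.
have {}uT : u \in `[0, T].
  move: uT sT; rewrite /= !in_itv/= => /andP[-> us] /andP[_].
  exact: le_trans.
pose g := (Y u)^T *m z.
have -> : (z^T *m (Y u *m (Pi u *m S *m Pi u + B *m Rm *m B^T) *m (Y u)^T) *m z)
    0 0 = sqnorm (invmx Q) (C *m (Pi u *m g)) + sqnorm Rm (B^T *m g).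
  by rewrite /sqnorm /g /S !mxexpand riccati_symm// mxD_entry.
by rewrite addr_ge0// spd_ge0//; exact: spd_inv.
Qed.

Lemma riccati_spd s : s \in `[0, T] -> spd (Pi s).
Proof.
move=> sT; split; first exact: riccati_symm.
have [Z [Y [_ Y0 _ pY YZ]]] := transition_matrices T0 closed_loop_bounded.
have [YZs ZYs] := YZ s sT.
move=> w w0; have YZw : (Y s)^T *m ((Z s)^T *m w) = w.
  by rewrite mulmxA -trmx_mul ZYs trmx1 mul1mx.
have := riccati_lower_bound Y0 pY ((Z s)^T *m w) sT.
rewrite YZw; apply: lt_le_trans; apply: Gam_spd.2.
by apply: contra_neq w0 => Zw; rewrite -YZw Zw mulmx0.
Qed.

End Riccati.
(** * Solutions in H^1 as primitives *)

Section SolutionSpaces.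
Context {R : realType}.

Lemma L2P n t (f : R -> 'cV[R]_n) : L2 t f <-> entrywise (square_integrable t) f.
Proof.
split=> [f2 i j|f2 i]; last by apply/Lfun2P; exact: f2.
by rewrite (ord1 j); apply/Lfun2P; exact: f2.
Qed.

Lemma H1_solution_bounded n t (x rhs : R -> 'cV[R]_n) : 0 <= t ->
  H1_solution t x rhs -> entrywise (bounded_measurable t) x.
Proof.
move=> t0 [dx [/L2P dx2 xE] _]; apply: (mxprimitive_bounded (dF := dx)) => //.
move=> i j; rewrite (ord1 j); split=> [|s st]; last exact: xE.
exact: square_integrable_integrable.
Qed.

(** Once the right-hand side is known to be square integrable, the almost
    everywhere equality with the weak derivative can be forgotten. *)
Lemma H1_solution_primitive n t (x rhs : R -> 'cV[R]_n) :
  entrywise (square_integrable t) rhs -> H1_solution t x rhs ->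
  mxprimitive t x rhs.
Proof.
move=> rhs2 [dx [/L2P dx2 xE] [N [mN N0 subN]]] i j; rewrite (ord1 j).
apply: (primitive_ae (df := fun s => dx s i 0)).
- exact: square_integrable_integrable.
- exists N; split=> // s ndx; apply: subN => /= dxs; apply: ndx => st.
  by rewrite dxs.
- split=> [|s st]; last exact: xE.
  exact: square_integrable_integrable.
Qed.

Lemma primitive_H1_solution n t (x rhs : R -> 'cV[R]_n) :
  entrywise (square_integrable t) rhs -> mxprimitive t x rhs ->
  H1_solution t x rhs.
Proof.
move=> rhs2 px; exists rhs; last by apply: aeW.
by split=> [|s st i]; [exact/L2P|have [_ ->] := px i 0].
Qed.

Lemma integrable_bilinear n p t (M : 'M[R]_(n, p)) (f : R -> 'cV[R]_n)
    (g : R -> 'cV[R]_p) :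
  entrywise (square_integrable t) f -> entrywise (square_integrable t) g ->
  integrable_on t (fun s => ((f s)^T *m M *m g s) 0 0).
Proof.
move=> f2 g2; have := integrable_mxM (entrywise_tr f2)
  (square_integrable_mxMl (bounded_measurable_mx_cst t M) g2).
by move=> /(_ 0 0); under eq_fun do rewrite mulmxA.
Qed.

Lemma integrable_sqnorm n t (M : 'M[R]_n) (f : R -> 'cV[R]_n) :
  entrywise (square_integrable t) f -> integrable_on t (fun s => sqnorm M (f s)).
Proof. by move=> f2; exact: integrable_bilinear. Qed.

End SolutionSpaces.

(** * The value function *)

Lemma inf_attained (R : realType) (E : set R) (a : R) :
  E a -> lbound E a -> inf E = a.
Proof.
move=> Ea lba; apply/eqP; rewrite eq_le ge_inf//=; last by exists a.
by apply: lb_le_inf => //; exists a.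
Qed.

Section Value.
Context {R : realType} (t : R) (n m r : nat) (A Gam : 'M[R]_n) (Rm : 'M[R]_m).
Context (Q : 'M[R]_r) (B : 'M[R]_(n, m)) (C : 'M[R]_(r, n)) (x0 : 'cV[R]_n).
Context (y : R -> 'cV[R]_r) (Pi : R -> 'M[R]_n) (xh : R -> 'cV[R]_n).
Hypotheses (t_gt0 : 0 < t) (Gam_spd : spd Gam) (Rm_spd : spd Rm) (Q_spd : spd Q).
Hypothesis y2 : entrywise (square_integrable t) y.
Hypothesis Pi_sol : riccati_solution t A Gam Rm Q B C Pi.
Hypothesis xh_prim : mxprimitive t xh (fun s =>
  A *m xh s + Pi s *m C^T *m invmx Q *m (y s - C *m xh s)).
Hypothesis xh0 : xh 0 = x0.

Let t0 : 0 <= t := ltW t_gt0.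
Let S := C^T *m invmx Q *m C.
Let F s := A - Pi s *m S.
Let eta s := y s - C *m xh s.
Let pPi := riccati_primitive Pi_sol.

Let t_in : t \in `[0, t]. Proof. by rewrite in_itv/= t0 lexx. Qed.

Let invQ_symm : (invmx Q)^T = invmx Q.
Proof. by case: (spd_inv Q_spd). Qed.

Let eta2 : entrywise (square_integrable t) eta.
Proof.
apply: square_integrable_mxB => //; apply: square_integrable_mxMcl.
apply: bounded_measurable_mx_square_integrable.
exact: mxprimitive_bounded xh_prim.
Qed.

(** The adjoint equation [p' = - F^T p - C^T Q^-1 eta], which is also
    [p' = - A^T p - C^T Q^-1 (y - C x)] along [x = xh + Pi p]. *)
Definition costate (p : R -> 'cV[R]_n) := mxprimitive t p
  (fun s => - ((F s)^T *m p s) - C^T *m invmx Q *m eta s).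

(** Variation of constants, [p = Y^T q] with [q' = - Z^T C^T Q^-1 eta]; the
    terminal value of [p] is prescribed through the constant of [q]. *)
Lemma costate_exists w : exists2 p, costate p & p t = w.
Proof.
have [Z [Y [Z0 Y0 pZ pY YZ]]] :=
  transition_matrices t0 (closed_loop_bounded t0 Pi_sol).
have bZ := mxprimitive_bounded t0 pZ.
pose dq s := (Z s)^T *m (C^T *m invmx Q *m eta s).
have dq1 : entrywise (integrable_on t) dq.
  apply: square_integrable_mx_integrable.
  apply: square_integrable_mxMl; first exact: entrywise_tr.
  exact: square_integrable_mxMcl.
pose q1 s : 'cV[R]_n :=
  \matrix_(i, j) ((0 : 'cV[R]_n) i j +
    \int[lebesgue_measure]_(u in `[0, s]) dq u i j).
have pq1 : mxprimitive t q1 dq by exact: mxprimitive_integral.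
pose q0 := (Z t)^T *m w + q1 t.
have pq := mxprimitiveB (mxprimitive_cst t q0) pq1.
exists (fun s => (Y s)^T *m (q0 - q1 s)).
  apply: eq_mxprimitive (mxprimitiveM t0 (mxprimitive_tr pY) pq) => s st.
  have [_ ZYs] := YZ s st.
  have ZYT : (Y s)^T *m (Z s)^T = 1%:M by rewrite -trmx_mul ZYs trmx1.
  rewrite sub0r mulmxN /dq [(Y s)^T *m (_ *m _)]mulmxA ZYT mul1mx.
  by rewrite -/S -/(F s); move: (F s) => X; rewrite trmxN trmx_mul mulNmx !mulmxA.
have [_ ZYs] := YZ t t_in.
by rewrite /q0 addrK mulmxA -trmx_mul ZYs trmx1 mul1mx.
Qed.

Section Optimal.
Context (p : R -> 'cV[R]_n) (p_costate : costate p).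

Let xopt s := xh s + Pi s *m p s.
Let vopt s := Rm *m B^T *m p s.

Let bp : entrywise (bounded_measurable t) p.
Proof. exact: mxprimitive_bounded p_costate. Qed.

(** The filter equation for [xh], the Riccati equation and the costate equation
    combine so that only [A (xh + Pi p) + B R B^T p] survives. *)
Lemma optimal_primitive :
  mxprimitive t xopt (fun s => A *m xopt s + B *m vopt s).
Proof.
apply: eq_mxprimitive (mxprimitiveD xh_prim (mxprimitiveM t0 pPi p_costate)).
move=> s st; have Pis := riccati_symm t0 Gam_spd Rm_spd Q_spd Pi_sol st.
rewrite /xopt /vopt /F -/(eta s) /S; move: (eta s) (invmx Q) invQ_symm => e W Ws.
by rewrite !mxexpand Pis Ws; mxring.
Qed.

Let vopt2 : entrywise (square_integrable t) vopt.
Proof.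
apply: square_integrable_mxMcl.
exact: bounded_measurable_mx_square_integrable.
Qed.

Let xopt2 : entrywise (square_integrable t) xopt.
Proof.
apply: bounded_measurable_mx_square_integrable.
exact: mxprimitive_bounded optimal_primitive.
Qed.

Lemma optimal_admissible : admissible A B t (xopt t) xopt vopt.
Proof.
split=> //; first exact/L2P.
apply: primitive_H1_solution optimal_primitive.
by apply: square_integrable_mxD; exact: square_integrable_mxMcl.
Qed.

Let zeta s := y s - C *m xopt s.

Let zeta2 : entrywise (square_integrable t) zeta.
Proof. by apply: square_integrable_mxB => //; exact: square_integrable_mxMcl. Qed.

Let zetaE s : zeta s = eta s - C *m (Pi s *m p s).
Proof. by rewrite /zeta /xopt mulmxDr opprD addrA. Qed.

Let sqnorm_vopt s :
  sqnorm (invmx Rm) (vopt s) = ((p s)^T *m (B *m Rm *m B^T) *m p s) 0 0.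
Proof.
have uR := spd_unit Rm_spd; have [Rs _] := Rm_spd.
by rewrite /sqnorm /vopt !mxexpand Rs mulmxKV.
Qed.

Let running_opt s := sqnorm (invmx Rm) (vopt s) + sqnorm (invmx Q) (zeta s).

(** The balance [(p^T Pi p)' = |v|^2 + |y - C x|^2 - |eta|^2], in the weighted norms, along
    the optimal trajectory; it evaluates the running cost. *)
Lemma costate_energy : primitive t (fun s => sqnorm (Pi s) (p s))
  (fun s => running_opt s - sqnorm (invmx Q) (eta s)).
Proof.
have := mxprimitiveM t0 (mxprimitiveM t0 (mxprimitive_tr p_costate) pPi) p_costate.
move=> /(_ 0 0); apply: eq_primitive => s st.
have Pis := riccati_symm t0 Gam_spd Rm_spd Q_spd Pi_sol st.
rewrite /running_opt sqnorm_vopt zetaE /F /S /sqnorm.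
move: (eta s) (invmx Q) invQ_symm => e W Ws.
by rewrite !mxexpand Pis Ws !(mxD_entry, mxN_entry); ring.
Qed.

(** The initial penalty of the optimal trajectory is half of [p^T Pi p] at time
    [0], as [xopt 0 - x0 = Gam p(0)]; it cancels the lower boundary term of
    [costate_energy]. *)
Lemma optimal_cost : cost Gam Rm Q C x0 y t xopt vopt =
  2^-1 * sqnorm (Pi t) (p t) +
  2^-1 * \int[lebesgue_measure]_(s in `[0, t]) sqnorm (invmx Q) (eta s).
Proof.
have [_ /(_ t t_in)] := costate_energy; rewrite RintegralB//; last 2 first.
- by apply: integrable_onD; exact: integrable_sqnorm.
- exact: integrable_sqnorm.
have [_ _ ->] := Pi_sol; rewrite /cost /xopt xh0.
have -> : x0 + Pi 0 *m p 0 - x0 = Gam *m p 0.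
  by have [_ _ ->] := Pi_sol; rewrite [x0 + _]addrC addrK.
have -> : sqnorm (invmx Gam) (Gam *m p 0) = sqnorm Gam (p 0).
  have [Gs _] := Gam_spd.
  by rewrite /sqnorm !mxexpand Gs mulmxKV// spd_unit.
have -> : \int[lebesgue_measure]_(s in `[0, t]) (sqnorm (invmx Rm) (vopt s) +
    sqnorm (invmx Q) (y s - C *m (xh s + Pi s *m p s))) =
  \int[lebesgue_measure]_(s in `[0, t]) running_opt s by [].
by move=> ->; ring.
Qed.

(** With deviations [d] of the state and [w] of the control, the cost is that of
    the optimal trajectory, plus a nonnegative quadratic part, plus a first
    variation [p(0)^T d(0) + int lin].  Since [(p^T d)' = lin] and [d(t) = 0],
    the first variation vanishes. *)
Lemma optimal_cost_le x v : admissible A B t (xopt t) x v ->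
  cost Gam Rm Q C x0 y t xopt vopt <= cost Gam Rm Q C x0 y t x v.
Proof.
move=> [/L2P v2 xsol xt].
have x2 : entrywise (square_integrable t) x.
  apply: bounded_measurable_mx_square_integrable.
  exact: H1_solution_bounded xsol.
have px : mxprimitive t x (fun s => A *m x s + B *m v s).
  apply: H1_solution_primitive xsol.
  by apply: square_integrable_mxD; exact: square_integrable_mxMcl.
pose d s := x s - xopt s; pose w s := v s - vopt s.
have pd : mxprimitive t d (fun s => A *m d s + B *m w s).
  apply: eq_mxprimitive (mxprimitiveB px optimal_primitive) => s _.
  by rewrite /d /w !mulmxBr opprD addrACA.
have d2 : entrywise (square_integrable t) d by exact: square_integrable_mxB.
have w2 : entrywise (square_integrable t) w by exact: square_integrable_mxB.
(* Half of the cross terms of the running cost. *)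
pose lin s := ((p s)^T *m B *m w s) 0 0 - ((zeta s)^T *m (invmx Q *m C) *m d s) 0 0.
have lin1 : integrable_on t lin.
  apply: integrable_onD; last apply: integrable_onN.
    apply: integrable_bilinear => //.
    exact: bounded_measurable_mx_square_integrable.
  exact: integrable_bilinear.
have plin : primitive t (fun s => ((p s)^T *m d s) 0 0) lin.
  have := mxprimitiveM t0 (mxprimitive_tr p_costate) pd => /(_ 0 0).
  apply: eq_primitive => s st.
  have Pis := riccati_symm t0 Gam_spd Rm_spd Q_spd Pi_sol st.
  rewrite /lin zetaE /F /S; move: (eta s) (invmx Q) invQ_symm => e W Ws.
  by rewrite !mxexpand Pis Ws !(mxD_entry, mxN_entry); ring.
have int_lin : \int[lebesgue_measure]_(s in `[0, t]) lin s = - ((p 0)^T *m d 0) 0 0.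
  have [_ /(_ t t_in)] := plin; rewrite {1}/d xt subrr mulmx0 mxE => /esym/eqP.
  by rewrite addrC addr_eq0 => /eqP.
have initial : sqnorm (invmx Gam) (x 0 - x0) =
    sqnorm (invmx Gam) (xopt 0 - x0) + sqnorm (invmx Gam) (d 0)
    + 2 * ((p 0)^T *m d 0) 0 0.
  have -> : x 0 - x0 = (xopt 0 - x0) + d 0 by rewrite /d [RHS]addrC addrA subrK.
  have [Gs _] := spd_inv Gam_spd; rewrite sqnormD//; congr (_ + 2 * _ 0 0).
  have -> : xopt 0 - x0 = Gam *m p 0.
    by have [_ _ Pi0] := Pi_sol; rewrite /xopt xh0 Pi0 [x0 + _]addrC addrK.
  have [Gs' _] := Gam_spd.
  by rewrite trmx_mul Gs' -!mulmxA mulKVmx// spd_unit.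
have running s : running_opt s + 2 * lin s <=
    sqnorm (invmx Rm) (v s) + sqnorm (invmx Q) (y s - C *m x s).
  have -> : v s = vopt s + w s by rewrite /w [RHS]addrC subrK.
  have -> : y s - C *m x s = zeta s - C *m d s.
    by rewrite /zeta /d mulmxBr opprB addrA subrK.
  have [invR_symm _] := spd_inv Rm_spd; rewrite sqnormD//.
  rewrite sqnormD//.
  have -> : sqnorm (invmx Q) (- (C *m d s)) = sqnorm (invmx Q) (C *m d s).
    by rewrite /sqnorm trmxN mulNmx mulmxN mulNmx opprK.
  have -> : ((vopt s)^T *m invmx Rm *m w s) 0 0 = ((p s)^T *m B *m w s) 0 0.
    have uR := spd_unit Rm_spd; have [Rs _] := Rm_spd.
    by rewrite /vopt !mxexpand Rs mulmxK.
  have -> : ((zeta s)^T *m invmx Q *m - (C *m d s)) 0 0 =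
      - ((zeta s)^T *m (invmx Q *m C) *m d s) 0 0.
    by rewrite mulmxN mxN_entry !mulmxA.
  have := spd_ge0 (w s) (spd_inv Rm_spd).
  have := spd_ge0 (C *m d s) (spd_inv Q_spd).
  by rewrite /running_opt /lin; lra.
have integ : integrable_on t (fun s =>
    sqnorm (invmx Rm) (v s) + sqnorm (invmx Q) (y s - C *m x s)).
  apply: integrable_onD; first exact: integrable_sqnorm.
  apply: integrable_sqnorm; apply: square_integrable_mxB => //.
  exact: square_integrable_mxMcl.
have iopt : integrable_on t running_opt.
  by apply: integrable_onD; exact: integrable_sqnorm.
have ilin : integrable_on t (fun s => 2 * lin s).
  by apply: integrable_on_mull => //; exact: bounded_measurable_cst.
have : \int[lebesgue_measure]_(s in `[0, t]) (running_opt s + 2 * lin s) <=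
  \int[lebesgue_measure]_(s in `[0, t])
     (sqnorm (invmx Rm) (v s) + sqnorm (invmx Q) (y s - C *m x s)).
  by apply: le_Rintegral => //; exact: (integrable_onD iopt ilin).
rewrite RintegralD// RintegralZl// int_lin /cost initial.
have := spd_ge0 (d 0) (spd_inv Gam_spd).
have -> : \int[lebesgue_measure]_(s in `[0, t]) (sqnorm (invmx Rm) (vopt s) +
    sqnorm (invmx Q) (y s - C *m xopt s)) =
  \int[lebesgue_measure]_(s in `[0, t]) running_opt s by [].
lra.
Qed.

End Optimal.

(** The costate with terminal value [Pi(t)^-1 (xi - xh t)] makes the optimal
    trajectory end at [xi]. *)
Lemma value_quadratic : exists c, forall xi,
  value A Gam Rm Q B C x0 y t xi =
  2^-1 * sqnorm (invmx (Pi t)) (xi - xh t) + c.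
Proof.
exists (2^-1 * \int[lebesgue_measure]_(s in `[0, t]) sqnorm (invmx Q) (eta s)).
move=> xi; rewrite /value (gt_eqF t_gt0).
have [p p_co pt] := costate_exists (invmx (Pi t) *m (xi - xh t)).
have sPi := riccati_spd t0 Gam_spd Rm_spd Q_spd Pi_sol t_in.
have uPi := spd_unit sPi.
have xopt_t : xh t + Pi t *m p t = xi.
  by rewrite pt mulKVmx// [LHS]addrC subrK.
have copt := optimal_cost p_co.
have adm := optimal_admissible p_co; have opt := optimal_cost_le p_co.
rewrite xopt_t in adm opt.
have -> : sqnorm (invmx (Pi t)) (xi - xh t) = sqnorm (Pi t) (p t).
  have [Pis _] := spd_inv sPi.
  by rewrite pt /sqnorm trmx_mul Pis !mulmxA mulmxKV.
rewrite -copt; apply: inf_attained; last by move=> _ [x [v [xv ->]]]; exact: opt.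
by exists (fun s => xh s + Pi s *m p s), (fun s => Rm *m B^T *m p s).
Qed.

End Value.
Section ValueOnHorizon.
Context {R : realType} (T : R) (n m r : nat) (A Gam : 'M[R]_n) (Rm : 'M[R]_m).
Context (Q : 'M[R]_r) (B : 'M[R]_(n, m)) (C : 'M[R]_(r, n)) (x0 : 'cV[R]_n).
Context (y : R -> 'cV[R]_r) (Pi : R -> 'M[R]_n) (xh : R -> 'cV[R]_n).

Lemma riccati_solution_le t : t <= T ->
  riccati_solution T A Gam Rm Q B C Pi -> riccati_solution t A Gam Rm Q B C Pi.
Proof.
move=> tT [cPi dPi Pi0]; split=> //.
  by apply: continuous_subspaceW cPi; apply: subset_itvl; rewrite bnd_simp.
move=> s; rewrite in_itv/= => /andP[s0 st].
by apply: dPi; rewrite in_itv/= s0 (lt_le_trans st).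
Qed.

Lemma filter_primitive : 0 <= T -> L2 T y ->
  riccati_solution T A Gam Rm Q B C Pi ->
  filter_solution T A Q C x0 y Pi xh ->
  mxprimitive T xh (fun s =>
    A *m xh s + Pi s *m C^T *m invmx Q *m (y s - C *m xh s)).
Proof.
move=> T0 /L2P y2 Pi_sol [xh_sol _].
have xh2 : entrywise (square_integrable T) xh.
  apply: bounded_measurable_mx_square_integrable.
  exact: H1_solution_bounded xh_sol.
apply: H1_solution_primitive xh_sol.
apply: square_integrable_mxD; first exact: square_integrable_mxMcl.
apply: square_integrable_mxMl.
  do 2 (apply: bounded_measurable_mxM; last exact: bounded_measurable_mx_cst).
  exact: mxprimitive_bounded (riccati_primitive Pi_sol).
by apply: square_integrable_mxB => //; exact: square_integrable_mxMcl.
Qed.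

Lemma value_is_quadratic t : spd Gam -> spd Rm -> spd Q -> L2 T y ->
  riccati_solution T A Gam Rm Q B C Pi ->
  filter_solution T A Q C x0 y Pi xh -> t \in `[0, T] ->
  exists c, forall xi, value A Gam Rm Q B C x0 y t xi =
    2^-1 * sqnorm (invmx (Pi t)) (xi - xh t) + c.
Proof.
move=> sG sR sQ yL2 Pi_sol xh_sol; rewrite in_itv/= => /andP[t0 tT].
have T0 := le_trans t0 tT; have [_ xh0] := xh_sol.
move: t0; rewrite le_eqVlt => /predU1P[<-|t_gt0].
  exists 0 => xi; have [_ _ Pi0] := Pi_sol.
  by rewrite /value eqxx addr0 xh0 Pi0.
apply: value_quadratic => //.
- by have /L2P y2 := yL2 => i j; exact: square_integrable_le (y2 i j).
- exact: riccati_solution_le Pi_sol.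
- exact: mxprimitive_le (filter_primitive T0 yL2 Pi_sol xh_sol).
Qed.

End ValueOnHorizon.

(** * The expected energy *)

Lemma Sigma_in (R : realType) (dA dG dR dQ : nat)
    (SA : {fset 'rV[R]_dA}) (SG : {fset 'rV[R]_dG})
    (SR : {fset 'rV[R]_dR}) (SQ : {fset 'rV[R]_dQ}) s :
  s \in Sigma SA SG SR SQ ->
  [/\ parA s \in SA, parGamma s \in SG, parR s \in SR & parQ s \in SQ].
Proof.
case: s => [[[a g] b] q]; rewrite /Sigma !in_fsetE /=.
by move=> /andP[/andP[/andP[]]].
Qed.

Lemma Sigma_neq0 (R : realType) (dA dG dR dQ : nat)
    (SA : {fset 'rV[R]_dA}) (SG : {fset 'rV[R]_dG})
    (SR : {fset 'rV[R]_dR}) (SQ : {fset 'rV[R]_dQ}) :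
  SA != fset0 -> SG != fset0 -> SR != fset0 -> SQ != fset0 ->
  exists s, s \in Sigma SA SG SR SQ.
Proof.
move=> /fset0Pn[a aA] /fset0Pn[g gG] /fset0Pn[b bR] /fset0Pn[q qQ].
by exists (a, g, b, q); rewrite /Sigma !in_fsetE /= aA gG bR qQ.
Qed.

Theorem proposition3p4 (R : realType) (T : R) (T_gt0 : 0 < T) (n m r : nat)
    (B : 'M[R]_(n, m)) (C : 'M[R]_(r, n)) (x0 : 'cV[R]_n)
    (y : R -> 'cV[R]_r) (yL2 : L2 T y)
    (dA dG dR dQ : nat)
    (SA : {fset 'rV[R]_dA}) (SG : {fset 'rV[R]_dG})
    (SR : {fset 'rV[R]_dR}) (SQ : {fset 'rV[R]_dQ})
    (SA_neq0 : SA != fset0) (SG_neq0 : SG != fset0)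
    (SR_neq0 : SR != fset0) (SQ_neq0 : SQ != fset0)
    (A : 'rV[R]_dA -> 'M[R]_n) (Gam : 'rV[R]_dG -> 'M[R]_n)
    (Rm : 'rV[R]_dR -> 'M[R]_m) (Q : 'rV[R]_dQ -> 'M[R]_r)
    (Gam_spd : forall s, s \in SG -> spd (Gam s))
    (Rm_spd : forall s, s \in SR -> spd (Rm s))
    (Q_spd : forall s, s \in SQ -> spd (Q s))
    (Pi : param R dA dG dR dQ -> R -> 'M[R]_n)
    (xh : param R dA dG dR dQ -> R -> 'cV[R]_n)
    (Pi_sol : forall s, s \in Sigma SA SG SR SQ ->
      riccati_solution T (A (parA s)) (Gam (parGamma s)) (Rm (parR s))
        (Q (parQ s)) B C (Pi s))
    (xh_sol : forall s, s \in Sigma SA SG SR SQ ->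
      filter_solution T (A (parA s)) (Q (parQ s)) C x0 y (Pi s) (xh s)) :
  let E := expected_energy SA SG SR SQ A Gam Rm Q B C x0 y in
  let xhE := fun t : R => argmin (E t) in
  let P := fun s t => invmx (Pi s t) in
  let calP := fun t : R => \sum_(s <- Sigma SA SG SR SQ) P s t in
  forall t : R, t \in `[0, T] ->
    (exists! xi : 'cV[R]_n, is_minimizer (E t) xi) /\
    calP t \in unitmx /\
    xhE t = invmx (calP t) *m
              \sum_(s <- Sigma SA SG SR SQ) P s t *m xh s t.
Proof.
move=> E xhE P calP t tT; set Sig := Sigma SA SG SR SQ.
have data s : s \in Sig ->
    spd (Gam (parGamma s)) /\ spd (Rm (parR s)) /\ spd (Q (parQ s)).
  by move=> /Sigma_in[_ sG sR sQ]; split; [|split]; auto.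
have Pspd s : s \in Sig -> spd (P s t).
  move=> sS; have [sG [sR sQ]] := data s sS; apply: spd_inv.
  exact: riccati_spd (ltW T_gt0) sG sR sQ (Pi_sol s sS) _ tT.
have [s0 s0S] : exists s, s \in Sig by exact: Sigma_neq0.
have Sig0 : (Sig : seq _) != [::] 
  by apply: contraTneq s0S => Sig0; rewrite -[_ \in _]/(s0 \in (Sig : seq _)) Sig0.
have cardSig : 0 < (#|` Sig|%:R)^-1 :> R.
  by rewrite invr_gt0 ltr0n cardfs_gt0; apply/fset0Pn; exists s0.
have [c valueE] : exists c, forall s, s \in Sig -> forall xi,
    value (A (parA s)) (Gam (parGamma s)) (Rm (parR s)) (Q (parQ s)) B C x0 y t xi
    = 2^-1 * sqnorm (P s t) (xi - xh s t) + c s.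
  have ex s : exists c, s \in Sig -> forall xi,
    value (A (parA s)) (Gam (parGamma s)) (Rm (parR s)) (Q (parQ s)) B C x0 y t xi
    = 2^-1 * sqnorm (P s t) (xi - xh s t) + c.
    have [sS|_] := boolP (s \in Sig); last by exists 0.
    have [sG [sR sQ]] := data s sS.
    have [c cE] := value_is_quadratic sG sR sQ yL2 (Pi_sol s sS) (xh_sol s sS) tT.
    by exists c.
  by exists (fun s => sval (cid (ex s))) => s; exact: (svalP (cid (ex s))).
have EE z : E t z = (#|` Sig|%:R)^-1 *
    (2^-1 * \sum_(s <- Sig) sqnorm (P s t) (z - xh s t) + \sum_(s <- Sig) c s).
  congr (_ * _); rewrite mulr_sumr -big_split/= big_seq [RHS]big_seq.
  by apply: eq_bigr => s sS; exact: valueE.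
set xi := invmx (calP t) *m _.
have [ximin xiuniq] : is_minimizer (E t) xi /\
    forall z, is_minimizer (E t) z -> z = xi.
  have calP_spd : spd (calP t) by exact: spd_sum.
  apply: (@quadratic_minimizer _ _ _ (calP t) ((#|` Sig|%:R)^-1 * 2^-1)) => //.
    by rewrite mulr_gt0.
  move=> z; rewrite !EE (sum_sqnorm_weighted_mean (fun s => xh s t) z Sig0 Pspd).
  by rewrite -/(calP t) -/xi; ring.
split; first by exists xi; split => // z /xiuniq.
split; first by apply: spd_unit; exact: spd_sum.
exact: argmin_eq.
Qed.
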